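(* Let $\mathcal{F}$ be a connected periodic framework in $\mathbb{R}^d$ with two vertex orbits, in which every edge has its endpoints in different vertex orbits. Then the configuration space of $\mathcal{F}$ has a natural compactification (via the Gram matrix map $G$ described in the context) as the boundary of a spectrahedron, which is itself linearly equivalent with an affine section of an elliptope. Topologically, this compactification is a sphere.
   Context: **Periodic frameworks.** A $d$-periodic graph is a pair $(H,\Gamma)$, where $H=(V,E)$ is a simple infinite graph with finite degree at every vertex, and $\Gamma\subset \mathrm{Aut}(H)$ is a free Abelian group of rank $d$ acting without fixed points and with finitely many vertex orbits (hence finitely many edge orbits). A placement of $(H,\Gamma)$ in $\mathbb{R}^d$ is a pair $(p,\pi)$ with $p:V\to\mathbb{R}^d$ and $\pi$ an injective homomorphism from $\Gamma$ to the translation group of $\mathbb{R}^d$ (identified with $\mathbb{R}^d$), with $\pi(\Gamma)$ a lattice of rank $d$, such that $p(\gamma v)=\pi(\gamma)(p(v))$ for all $v\in V,\gamma\in\Gamma$. A $d$-periodic framework $\mathcal{F}=(H,\Gamma,p,\pi)$ is a $d$-periodic graph with a placement; it is connected when $H$ is connected. The realization space of $\mathcal{F}$ is the set of all placements of $(H,\Gamma)$ in $\mathbb{R}^d$ that have the same edge lengths as $\mathcal{F}$; the configuration space is its quotient (with the quotient topology) by equivalence under Euclidean isometries of $\mathbb{R}^d$. **Gram matrix map.** Fix a vertex of $\mathcal{F}$, placed at the origin, and let $v_0,\dots,v_{m-1}\in\mathbb{R}^d$ be the edge vectors emanating from it; edge lengths are assumed positive and $\langle v_i,v_i\rangle=s_i>0$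 are the prescribed squared lengths. All endpoints of these vectors lie in the opposite vertex orbit, connectedness forces $m\ge d+1$, and the periodicity lattice is generated by the differences of the $v_i$. Label so that $\mu_j=v_j-v_0$, $j=1,\dots,d$, is a basis of $\mathbb{R}^d$. The remaining period vectors $v_k-v_0$, $k=d+1,\dots,m-1$, are unique linear combinations with rational coefficients of $\mu_1,\dots,\mu_d$, and these relations are preserved in all placements of $(H,\Gamma)$. Thus a configuration is determined up to isometry by the positive semidefinite $(d+1)\times(d+1)$ Gram matrix $G=(\langle v_i,v_j\rangle)_{0\le i,j\le d}$. This matrix satisfies $g_{ii}=s_i$ for $i=0,\dots,d$, together with the conditions $\langle v_k,v_k\rangle=s_k$ for $k>d$, which are affine-linear conditions on $G$ after substituting the expressions of $v_k$ in terms of $v_0,\dots,v_d$. The spectrahedron in question is the set of positive semidefinite matrices $G$ satisfying all these conditions, and its boundary is taken within the affine subspace defined by these conditions. **Spectrahedra and elliptopes.** A spectrahedron is the intersection of a cone of positive semidefinite symmetric matrices with an affine subspace of the space of symmetric matrices. The elliptope is the spectrahedron of correlation matrices of a given size: positive semidefinite symmetric matrices with all diagonal entries equal to $1$ (here of size $(d+1)\times(d+1)$).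
   Formalization: The boundary and sphere claims assume the spectrahedron contains a positive definite matrix (they fail otherwise); density of the configuration space in the boundary, false in general, is replaced by: its image is exactly the boundary points with nondegenerate period lattice. *)

(* Defs.v *)
From HB Require Import structures.
From mathcomp Require Import all_boot all_order all_algebra.
From mathcomp Require Import all_classical all_reals all_analysis.

Set Implicit Arguments.
Unset Strict Implicit.
Unset Printing Implicit Defensive.

Import Order.TTheory GRing.Theory Num.Theory.
Import numFieldNormedType.Exports.

Local Open Scope classical_set_scope.
Local Open Scope ring_scope.
Local Open Scope quotient_scope.

(* The norm that the library puts on ['rV[R]_d] is the sup norm; the Euclidean
   norm is therefore introduced separately.  Both give the same topology. *)
Definition dot (R : realType) (d : nat) (x y : 'rV[R]_d) : R :=
  \sum_(i < d) x 0 i * y 0 i.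

Definition enorm (R : realType) (d : nat) (x : 'rV[R]_d) : R :=
  Num.sqrt (dot x x).

Definition euclidean_isometry (R : realType) (d : nat)
    (f : 'rV[R]_d -> 'rV[R]_d) : Prop :=
  bijective f /\ forall x y, enorm (f x - f y) = enorm (x - y).

Definition sphere (R : realType) (n : nat) : set 'rV[R]_n.+1 :=
  [set x | enorm x = 1].

Arguments sphere : clear implicits.

Definition homeomorphic (X Y : topologicalType) : Prop :=
  exists (f : X -> Y) (g : Y -> X),
    [/\ continuous f, continuous g, cancel f g & cancel g f].

Definition embedding (X Y : topologicalType) (f : X -> Y) : Prop :=
  injective f /\
  forall U : set X, open U <-> exists2 W : set Y, open W & f @^-1` W = U.

(* The image is required to be open in [K], but not dense: see the remark
   before [period_gram] below. *)
Definition compactifies (X Y : topologicalType) (f : X -> Y) (K : set Y) :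
    Prop :=
  [/\ compact K, embedding f & exists2 U, open U & range f = K `&` U].

Definition boundary_in (X : topologicalType) (A S : set X) : set X :=
  A `&` closure S `&` closure (A `\` S).

Definition free_abelian (d : nat) (G : zmodType) : Prop :=
  exists b : 'I_d -> G,
    forall g, exists! c : {ffun 'I_d -> int}, g = \sum_(i < d) b i *~ c i.

(* The group [period] is written additively; being free and the vertex set
   being nonempty, the action is faithful, so that [period] is identified with
   a subgroup of the automorphism group of the graph. *)
Record periodicGraph (d : nat) := PeriodicGraph {
  vertex : Type;
  adj : rel vertex;
  adj_sym : symmetric adj;
  adj_irr : irreflexive adj;
  vertex_infinite : infinite_set [set: vertex];
  finite_degree : forall v, finite_set [set w | adj v w];
  period : zmodType;
  period_free : free_abelian d period;
  act : period -> vertex -> vertex;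
  act0 : forall v, act 0 v = v;
  actD : forall g h v, act (g + h) v = act g (act h v);
  act_adj : forall g v w, adj (act g v) (act g w) = adj v w;
  act_free : forall g v, act g v = v -> g = 0;
  finite_orbits : exists2 s : set vertex, finite_set s &
    forall v, exists2 w, s w & exists g, v = act g w }.

Definition lattice (R : realType) (d : nat) (L : set 'rV[R]_d) : Prop :=
  exists2 B : 'M[R]_d, B \in unitmx &
    L = [set x | exists c : 'rV[int]_d, x = map_mx intr c *m B].

(* Pairs (p, pi), with the topology of pointwise convergence. *)
Definition preplacement (R : realType) (d : nat) (H : periodicGraph d) :
    topologicalType :=
  ({ptws vertex H -> 'rV[R]_d} * {ptws period H -> 'rV[R]_d})%type.

Definition placement (R : realType) (d : nat) (H : periodicGraph d)
    (x : preplacement R H) : Prop :=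
  [/\ injective x.2,
      forall g h, x.2 (g + h) = x.2 g + x.2 h,
      lattice (range x.2) &
      forall g v, x.1 (act g v) = x.1 v + x.2 g].

Record periodicFramework (R : realType) (d : nat) := PeriodicFramework {
  graph : periodicGraph d;
  place : preplacement R graph;
  placeP : placement place }.

Section Framework.
Variables (R : realType) (d : nat) (F : periodicFramework R d).

Local Notation V := (vertex (graph F)).
Local Notation e := (@adj d (graph F)).

Definition connected_framework : Prop :=
  forall v w : V, exists2 s : seq V, path e v s & last v s = w.

Definition same_orbit (v w : V) : Prop := exists g, w = act g v.

Definition two_orbits : Prop :=
  exists a b : V, ~ same_orbit a b /\
    forall v, same_orbit a v \/ same_orbit b v.

Definition edges_join_orbits : Prop :=
  forall v w : V, e v w -> ~ same_orbit v w.

Definition edge_length (x : preplacement R (graph F)) (v w : V) : R :=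
  enorm (x.1 w - x.1 v).

Definition positive_edge_lengths : Prop :=
  forall v w : V, e v w -> 0 < edge_length (place F) v w.

Definition realization : set (preplacement R (graph F)) :=
  [set x | placement x /\
    forall v w, e v w -> edge_length x v w = edge_length (place F) v w].

(* The last condition says that [f] conjugates the translation by [x.2 g]
   to the translation by [y.2 g]. *)
Definition congruent (x y : realization) : Prop :=
  exists f : 'rV[R]_d -> 'rV[R]_d,
    [/\ euclidean_isometry f,
        forall v, (val y).1 v = f ((val x).1 v) &
        forall g z, f (z + (val x).2 g) = f z + (val y).2 g].

Definition congruentb (x y : realization) : bool := `[< congruent x y >].

Lemma congruentb_refl : reflexive congruentb.
Proof.
move=> x; apply/asboolP; exists id; split=> //; split=> //.
by exists id.
Qed.

Lemma congruent_sym x y : congruent x y -> congruent y x.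
Proof.
move=> [f [[[f' fK f'K] fI] fp fg]]; exists f'; split.
- split; first by exists f.
  by move=> a b; rewrite -fI !f'K.
- by move=> v; rewrite fp fK.
- by move=> g z; apply: (can_inj fK); rewrite fg !f'K.
Qed.

Lemma congruentb_sym : symmetric congruentb.
Proof. by move=> x y; apply/asboolP/asboolP; exact: congruent_sym. Qed.

Lemma congruentb_trans : transitive congruentb.
Proof.
move=> y x z /asboolP[f [[fB fI] fp fg]] /asboolP[h [[hB hI] hp hg]].
apply/asboolP; exists (h \o f); split.
- by split=> [|a b]; [exact: bij_comp | rewrite /= hI fI].
- by move=> v; rewrite hp fp.
- by move=> g w /=; rewrite fg hg.
Qed.

Canonical congruentb_equiv :=
  EquivRel congruentb congruentb_refl congruentb_sym congruentb_trans.

Definition configuration : topologicalType :=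
  quotient_topology {eq_quot congruentb_equiv}.

Definition config_class (x : realization) : configuration :=
  \pi_(quotient_topology {eq_quot congruentb_equiv}) x.

Lemma config_classP (x y : realization) :
  config_class x = config_class y <-> congruent x y.
Proof.
split=> [/(eqmodP congruentb_equiv)/asboolP //|xy].
by apply/(eqmodP congruentb_equiv)/asboolP.
Qed.

Lemma config_class_surj (c : configuration) : exists x, config_class x = c.
Proof. by exists (repr (c : {eq_quot congruentb_equiv})); exact: reprK. Qed.

Lemma config_class_open (U : set configuration) :
  open U = open (config_class @^-1` U).
Proof. by []. Qed.

Variables (u : V) (r : nat) (nb : 'I_(d.+1 + r) -> V).

Definition edge_vector (x : preplacement R (graph F)) (k : 'I_(d.+1 + r)) :
    'rV[R]_d :=
  x.1 (nb k) - x.1 u.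

Definition period_vector (x : preplacement R (graph F)) (k : 'I_(d.+1 + r)) :
    'rV[R]_d :=
  edge_vector x k - edge_vector x (lshift r ord0).

Definition basis_vector (x : preplacement R (graph F)) (j : 'I_d) : 'rV[R]_d :=
  period_vector x (lshift r (lift ord0 j)).

Variable q : 'M[rat]_(r, d).

(* [nb] lists the m = d + 1 + r neighbours of [u]: [lshift r i] is the index
   i <= d, and [rshift d.+1 k] is the index d + 1 + k > d. *)
Definition gram_labelling : Prop :=
  [/\ injective nb,
      range nb = [set w | e u w],
      \matrix_j basis_vector (place F) j \in unitmx &
      forall k, period_vector (place F) (rshift d.+1 k) =
                \sum_(j < d) ratr (q k j) *: basis_vector (place F) j].

Definition gram (x : preplacement R (graph F)) : 'M[R]_d.+1 :=
  \matrix_(i, j) dot (edge_vector x (lshift r i)) (edge_vector x (lshift r j)).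

Definition sq_length (k : 'I_(d.+1 + r)) : R :=
  dot (edge_vector (place F) k) (edge_vector (place F) k).

(* Coefficients of v_(d+1+k) on v_0, ..., v_d: from
   v_(d+1+k) - v_0 = \sum_j q k j (v_(j+1) - v_0), they are
   1 - \sum_j q k j on v_0 and q k j on v_(j+1). *)
Definition edge_coef (k : 'I_r) : 'rV[R]_d.+1 :=
  \row_i if unlift ord0 i is Some j then ratr (q k j)
         else 1 - \sum_(j < d) ratr (q k j).

Definition gram_affine : set 'M[R]_d.+1 :=
  [set G | [/\ G^T = G,
               forall i, G i i = sq_length (lshift r i) &
               forall k, (edge_coef k *m G *m (edge_coef k)^T) 0 0 =
                         sq_length (rshift d.+1 k)]].

End Framework.

Arguments realization {R d} F.

Definition psd (R : realType) (n : nat) : set 'M[R]_n :=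
  [set G | G^T = G /\ forall x : 'rV[R]_n, 0 <= (x *m G *m x^T) 0 0].

Arguments psd : clear implicits.

Definition posdef (R : realType) (n : nat) : set 'M[R]_n :=
  [set G | G^T = G /\
    forall x : 'rV[R]_n, x != 0 -> 0 < (x *m G *m x^T) 0 0].

Definition affine_subspace (R : realType) (n : nat) (A : set 'M[R]_n) : Prop :=
  (forall G, A G -> G^T = G) /\
  forall (t : R) G H, A G -> A H -> A ((1 - t) *: G + t *: H).

Definition spectrahedron (R : realType) (n : nat) (S : set 'M[R]_n) : Prop :=
  exists2 A, affine_subspace A & S = psd R n `&` A.

Definition elliptope (R : realType) (n : nat) : set 'M[R]_n :=
  [set G | psd R n G /\ forall i, G i i = 1].

Arguments elliptope : clear implicits.

(* The linear map is an automorphism of the space of all square matrices that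
   restricts to an automorphism of the space of symmetric matrices. *)
Definition linearly_equivalent (R : realType) (n : nat) (S T : set 'M[R]_n) :
    Prop :=
  exists f : {linear 'M[R]_n -> 'M[R]_n},
    [/\ bijective f, forall G, (f G)^T = f G <-> G^T = G & f @` S = T].

Definition gram_spectrahedron (R : realType) (d : nat)
    (F : periodicFramework R d) (u : vertex (graph F)) (r : nat)
    (nb : 'I_(d.+1 + r) -> vertex (graph F)) (q : 'M[rat]_(r, d)) :
    set 'M[R]_d.+1 :=
  psd R d.+1 `&` gram_affine u nb q.

Definition gram_boundary (R : realType) (d : nat)
    (F : periodicFramework R d) (u : vertex (graph F)) (r : nat)
    (nb : 'I_(d.+1 + r) -> vertex (graph F)) (q : 'M[rat]_(r, d)) :
    set 'M[R]_d.+1 :=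
  boundary_in (gram_affine u nb q) (gram_spectrahedron u nb q).

(* Without this condition the boundary need not be a sphere containing the
   configuration space.  For d = 1 and edge vectors x, x + l, x + 3l, where l is
   the generator of the period lattice, the configuration space, the
   spectrahedron and its affine subspace are one and the same point.  For d = 2
   and edge vectors x, x + l, x + 3l, x + l' with x parallel to l but not to l',
   the spectrahedron is a segment in an affine plane, equal to its boundary.
   If no element of the spectrahedron is positive definite, then either the
   boundary is the whole spectrahedron, or it does not contain the Gram matrix
   of the given placement. *)
Definition meets_cone_interior (R : realType) (n : nat) (S : set 'M[R]_n) :
    Prop :=
  exists2 G, S G & posdef G.

(* [period_gram G] is the Gram matrix of v_j - v_0, 1 <= j <= d, when [G] is
   that of v_0, ..., v_d.  Compactifying adds the boundary points for which
   these period vectors are linearly dependent.  They may contain an open part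
   of the boundary, so that the configuration space need not be dense: when the
   two orbits are the points of a square lattice and the centres of its squares,
   each centre being joined to the four corners around it, the boundary is a
   triangle, and the configuration space is one open side of it. *)
Definition period_gram (R : realType) (d : nat) (G : 'M[R]_d.+1) : 'M[R]_d :=
  \matrix_(i, j) (G (lift ord0 i) (lift ord0 j) - G (lift ord0 i) ord0
                  - G ord0 (lift ord0 j) + G ord0 ord0).

Definition lattice_nondegenerate (R : realType) (d : nat) : set 'M[R]_d.+1 :=
  [set G | period_gram G \in unitmx].

Arguments lattice_nondegenerate : clear implicits.

(* Main.v *)
(* The period vectors v_j - v_0 at a vertex u generate a subgroup of finite index
   of the period group, so any two placements differ on periods by one linear map;
   hence a placement is determined up to isometry by the Gram matrix G of
   v_0, ..., v_d.  Conversely G is a Gram matrix of a placement as soon as it lies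
   in the spectrahedron, is singular (d + 1 vectors in dimension d) and has
   invertible Gram matrix of periods: a Cholesky factor of the latter gives the
   period vectors, and a kernel vector of G then expresses v_0 through them.
   Since the Cholesky factor depends continuously on G, this inverse of the Gram
   map is continuous, and the Gram map is an embedding.

   If the spectrahedron contains a positive definite matrix, its boundary in its
   affine subspace consists of its singular elements, and radial projection from
   the positive definite matrix maps this compact set bijectively and continuously
   onto a sphere.  The dimension of the affine subspace is positive because the
   given placement has a singular Gram matrix. *)
Require Import Defs.
From HB Require Import structures.
From mathcomp Require Import all_boot all_order all_algebra.
From mathcomp Require Import all_classical all_reals all_analysis.
From mathcomp Require Import ring lra.

Set Implicit Arguments.
Unset Strict Implicit.
Unset Printing Implicit Defensive.

Import Order.TTheory GRing.Theory Num.Theory.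
Import numFieldNormedType.Exports.

Local Open Scope classical_set_scope.
Local Open Scope ring_scope.

(** * Entrywise limits of matrices *)

Section MatrixTopology.
Context {T : Type} {F : set_system T} {FF : Filter F}.

(** A basic neighbourhood of a matrix prescribes a neighbourhood for each entry, and a filter is
    stable under the finite intersection over all entries. *)
Lemma cvg_mx (U : topologicalType) m n (f : T -> 'M[U]_(m, n)) (M : 'M[U]_(m, n)) :
  (forall i j, f x i j @[x --> F] --> M i j) -> f @ F --> M.
Proof.
move=> fM A [P MP PA].
have : \forall x \near F, forall i j, P i j (f x i j).
  by apply: filter_forall => i; apply: filter_forall => j; exact: fM (MP i j).
by apply: filterS => x Px; apply: PA.
Qed.

Variable R : realType.

Lemma cvg_coord m n (f : T -> 'M[R]_(m, n)) (M : 'M[R]_(m, n)) i j :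
  f @ F --> M -> f x i j @[x --> F] --> M i j.
Proof.
move=> fM; exact: (cvg_comp f (fun M : 'M[R]_(m, n) => M i j) fM (@coord_continuous R m n i j M)).
Qed.

Lemma cvg_fsum (I : Type) (r : seq I) (P : pred I) (f : I -> T -> R) (a : I -> R) :
  (forall i, f i @ F --> a i) ->
  \sum_(i <- r | P i) f i x @[x --> F] --> \sum_(i <- r | P i) a i.
Proof.
move=> fa; elim: r => [|i r IH].
  rewrite big_nil; under eq_fun do rewrite big_nil; exact: cvg_cst.
rewrite big_cons; under eq_fun do rewrite big_cons.
by case: (P i) => //; apply: cvgD.
Qed.

Lemma cvg_fprod (I : Type) (r : seq I) (P : pred I) (f : I -> T -> R) (a : I -> R) :
  (forall i, f i @ F --> a i) ->
  \prod_(i <- r | P i) f i x @[x --> F] --> \prod_(i <- r | P i) a i.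
Proof.
move=> fa; elim: r => [|i r IH].
  rewrite big_nil; under eq_fun do rewrite big_nil; exact: cvg_cst.
rewrite big_cons; under eq_fun do rewrite big_cons.
by case: (P i) => //; apply: cvgM.
Qed.

Lemma cvg_mulmx m n p (f : T -> 'M[R]_(m, n)) (g : T -> 'M[R]_(n, p))
    (A : 'M[R]_(m, n)) (B : 'M[R]_(n, p)) :
  f @ F --> A -> g @ F --> B -> f x *m g x @[x --> F] --> A *m B.
Proof.
move=> fA gB; apply: cvg_mx => i j; rewrite mxE.
under eq_fun do rewrite mxE.
by apply: cvg_fsum => k; apply: cvgM; exact: cvg_coord.
Qed.

Lemma cvg_trmx m n (f : T -> 'M[R]_(m, n)) (A : 'M[R]_(m, n)) :
  f @ F --> A -> (f x)^T @[x --> F] --> A^T.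
Proof.
move=> fA; apply: cvg_mx => i j; rewrite mxE.
under eq_fun do rewrite mxE.
exact: cvg_coord.
Qed.

Lemma cvg_det n (f : T -> 'M[R]_n) (A : 'M[R]_n) :
  f @ F --> A -> \det (f x) @[x --> F] --> \det A.
Proof.
move=> fA; rewrite /determinant; apply: cvg_fsum => s.
apply: cvgM; first exact: cvg_cst.
by apply: cvg_fprod => i; exact: cvg_coord.
Qed.

(** Near [A] the determinant stays nonzero, so [invmx] is there the adjugate divided by the
    determinant. *)
Lemma cvg_invmx n (f : T -> 'M[R]_n) (A : 'M[R]_n) : A \in unitmx ->
  f @ F --> A -> invmx (f x) @[x --> F] --> invmx A.
Proof.
move=> uA fA.
have dA : \det A != 0 by rewrite -unitfE -unitmxE.
have df := cvg_det fA.
have fu : \forall x \near F, f x \in unitmx.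
  have : nbhs (\det A) [set y : R | y != 0].
    by apply: open_nbhs_nbhs; split => //; exact: open_neq.
  move=> h; apply: (@filterS _ F _ _ _ _ (df _ h)) => x.
  by rewrite /= unitmxE unitfE.
have -> : invmx A = (\det A)^-1 *: \adj A by rewrite /invmx uA.
have : (\det (f x))^-1 *: \adj (f x) @[x --> F] --> (\det A)^-1 *: \adj A.
  apply: cvg_mx => i j; rewrite !mxE.
  under eq_fun do rewrite !mxE.
  apply: cvgM; first exact: cvgV.
  rewrite /cofactor; apply: cvgM; first exact: cvg_cst.
  apply: cvg_det; apply: cvg_mx => k l; rewrite !mxE.
  under eq_fun do rewrite !mxE.
  exact: cvg_coord.
apply: cvg_trans; apply: near_eq_cvg.
by apply: filterS fu => x ux; rewrite /invmx ux.
Qed.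

End MatrixTopology.

(** * Quadratic forms, positive definite matrices and Cholesky factors *)

Section Forms.
Variable R : realType.

Definition qf n (G : 'M[R]_n) (x : 'rV[R]_n) : R := (x *m G *m x^T) 0 0.

Lemma dotE n (x y : 'rV[R]_n) : dot x y = (x *m y^T) 0 0.
Proof. by rewrite mxE; apply: eq_bigr => i _; rewrite mxE. Qed.

Lemma dotC n (x y : 'rV[R]_n) : dot x y = dot y x.
Proof. by apply: eq_bigr => i _; rewrite mulrC. Qed.

Lemma dotDl n (x y z : 'rV[R]_n) : dot (x + y) z = dot x z + dot y z.
Proof. by rewrite !dotE mulmxDl mxE. Qed.

Lemma dotZl n a (x z : 'rV[R]_n) : dot (a *: x) z = a * dot x z.
Proof. by rewrite !dotE -scalemxAl mxE. Qed.

Lemma dotBl n (x y z : 'rV[R]_n) : dot (x - y) z = dot x z - dot y z.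
Proof. by rewrite -scaleN1r dotDl dotZl mulN1r. Qed.

Lemma dot_ge0 n (x : 'rV[R]_n) : 0 <= dot x x.
Proof. by apply: sumr_ge0 => i _; rewrite -expr2 sqr_ge0. Qed.

Lemma dot_eq0 n (x : 'rV[R]_n) : (dot x x == 0) = (x == 0).
Proof.
apply/idP/eqP => [|->]; last by rewrite dotE mul0mx mxE.
rewrite psumr_eq0 => [/allP x0|i _]; last by rewrite -expr2 sqr_ge0.
apply/rowP => i; rewrite mxE; apply/eqP; rewrite -sqrf_eq0 expr2.
by apply: (implyP (x0 i _)) => //; rewrite mem_index_enum.
Qed.

Lemma dot_gt0 n (x : 'rV[R]_n) : (0 < dot x x) = (x != 0).
Proof. by rewrite lt_def dot_eq0 dot_ge0 andbT. Qed.

Lemma enorm_sqr n (x : 'rV[R]_n) : enorm x ^+ 2 = dot x x.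
Proof. by rewrite sqr_sqrtr // dot_ge0. Qed.

Lemma enorm_eq n m (x : 'rV[R]_n) (y : 'rV[R]_m) :
  (enorm x = enorm y) <-> (dot x x = dot y y).
Proof. by split=> [xy|]; [rewrite -!enorm_sqr xy | rewrite /enorm => ->]. Qed.

Lemma enorm_gt0 n (x : 'rV[R]_n) : (0 < enorm x) = (x != 0).
Proof. by rewrite sqrtr_gt0 dot_gt0. Qed.

Lemma enormZ n a (x : 'rV[R]_n) : enorm (a *: x) = `|a| * enorm x.
Proof.
by rewrite /enorm dotZl dotC dotZl mulrA -expr2 sqrtrM ?sqr_ge0 // sqrtr_sqr.
Qed.

Lemma dot_polar n (x y : 'rV[R]_n) :
  dot x y = (dot x x + dot y y - dot (x - y) (x - y)) / 2.
Proof.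
rewrite dotBl ![dot _ (x - y)]dotC !dotBl (dotC y x).
have -> : dot x x + dot y y - (dot x x - dot x y - (dot x y - dot y y)) =
  dot x y * 2 by ring.
by rewrite mulfK // pnatr_eq0.
Qed.

Lemma qfE n (G : 'M[R]_n) x : qf G x = dot (x *m G) x.
Proof. by rewrite dotE. Qed.

Lemma qf_mul n m (G : 'M[R]_n) (B : 'M[R]_(m, n)) x :
  qf (B *m G *m B^T) x = qf G (x *m B).
Proof. by rewrite /qf trmx_mul !mulmxA. Qed.

Lemma qf_gram n m (V : 'M[R]_(m, n)) x : qf (V *m V^T) x = dot (x *m V) (x *m V).
Proof. by rewrite dotE /qf trmx_mul !mulmxA. Qed.

Lemma qfD n (G H : 'M[R]_n) x : qf (G + H) x = qf G x + qf H x.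
Proof. by rewrite /qf mulmxDr mulmxDl mxE. Qed.

Lemma qfZ n a (G : 'M[R]_n) x : qf (a *: G) x = a * qf G x.
Proof. by rewrite /qf -scalemxAr -scalemxAl mxE. Qed.

Lemma qf_scale n (G : 'M[R]_n) a x : qf G (a *: x) = a ^+ 2 * qf G x.
Proof.
by rewrite /qf linearZ /= -!scalemxAl -scalemxAr !mxE mulrA expr2.
Qed.

Lemma qf_delta n (G : 'M[R]_n) i : qf G (delta_mx 0 i) = G i i.
Proof. by rewrite /qf trmx_delta -rowE -colE !mxE. Qed.

Lemma psd_kernel n (G : 'M[R]_n) x : psd R n G -> qf G x = 0 -> x *m G = 0.
Proof.
move=> [sG pG] Gx0.
set y := x *m G.
(* Without the term in [qf G x], the form is affine in [t] along this line. *)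
have qE t : qf G (t *: x - y) = qf G y - t * 2 * dot y y.
  rewrite qfE dotC dotBl dotZl mulmxBl -scalemxAl !(dotC _ (t *: _ - _)).
  rewrite !dotBl !dotZl -/y.
  have -> : dot (y *m G) x = dot y y.
    by rewrite dotE -mulmxA -{1}sG -trmx_mul -dotE.
  have -> : dot y x = 0 by rewrite -Gx0 qfE.
  rewrite -qfE.
  ring.
apply/eqP; rewrite -/y -dot_eq0; apply: contraT => y0.
have yy : 0 < dot y y by rewrite dot_gt0 -dot_eq0.
(* This value of [t] makes the form equal to -1, against semidefiniteness. *)
have := pG (((qf G y + 1) / (2 * dot y y)) *: x - y).
rewrite -/(qf _ _) qE.
have -> : (qf G y + 1) / (2 * dot y y) * 2 * dot y y = qf G y + 1.
  by field; rewrite y0.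
by rewrite opprD addNKr oppr_ge0 ler10.
Qed.

Lemma psd_unit_posdef n (G : 'M[R]_n) : psd R n G -> G \in unitmx -> posdef G.
Proof.
move=> pG uG; split=> [|x x0]; first by case: pG.
rewrite lt_def (proj2 pG x) andbT; apply: contra x0 => /eqP /(psd_kernel pG).
by move=> /(congr1 (mulmx^~ (invmx G))); rewrite mulmxK // mul0mx => ->.
Qed.

Lemma posdef_psd n (G : 'M[R]_n) : posdef G -> psd R n G.
Proof.
move=> [sG pG]; split=> // x; have [->|x0] := eqVneq x 0; last exact/ltW/pG.
by rewrite !mul0mx mxE.
Qed.

Lemma gram_psd m n (V : 'M[R]_(m, n)) : psd R m (V *m V^T).
Proof.
split=> [|x]; first by rewrite trmx_mul trmxK.
by rewrite -/(qf _ _) qf_gram dot_ge0.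
Qed.

(** The strict bound on [t] leaves a positive weight on the definite matrix [G]. *)
Lemma posdef_convex n (G H : 'M[R]_n) t : posdef G -> psd R n H -> 0 <= t -> t < 1 ->
  posdef ((1 - t) *: G + t *: H).
Proof.
move=> [sG pG] [sH pH] t0 t1; split=> [|x x0].
  by rewrite linearD !linearZ /= sG sH.
rewrite -/(qf _ _) qfD !qfZ ltr_pwDl //.
  by rewrite mulr_gt0 ?subr_gt0 // pG.
by rewrite mulr_ge0 // pH.
Qed.

(** A nonzero zero of a semidefinite form is a kernel vector of its matrix. *)
Lemma not_posdef n (G : 'M[R]_n) : psd R n G -> ~ posdef G ->
  exists2 x : 'rV[R]_n, x != 0 & x *m G = 0.
Proof.
move=> pG nG; apply: contrapT => h; apply: nG.
split=> [|x x0]; first by case: pG.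
rewrite lt_def (proj2 pG x) andbT; apply/eqP => /(psd_kernel pG) xG.
by apply: h; exists x.
Qed.

Lemma cvg_qf (T : Type) (F : set_system T) {FF : Filter F} n
    (f : T -> 'M[R]_n) (g : T -> 'rV[R]_n) (A : 'M[R]_n) (x : 'rV[R]_n) :
  f @ F --> A -> g @ F --> x -> qf (f t) (g t) @[t --> F] --> qf A x.
Proof.
move=> fA gx; apply: cvg_coord; apply: cvg_mulmx; last exact: cvg_trmx.
exact: cvg_mulmx.
Qed.

Lemma cvg_dot (T : Type) (F : set_system T) {FF : Filter F} n
    (f g : T -> 'rV[R]_n) (x y : 'rV[R]_n) :
  f @ F --> x -> g @ F --> y -> dot (f t) (g t) @[t --> F] --> dot x y.
Proof.
move=> fx gy; rewrite dotE; under eq_fun do rewrite dotE.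
by apply: cvg_coord; apply: cvg_mulmx => //; exact: cvg_trmx.
Qed.

Lemma cvg_enorm (T : Type) (F : set_system T) {FF : Filter F} n
    (f : T -> 'rV[R]_n) (x : 'rV[R]_n) :
  f @ F --> x -> enorm (f t) @[t --> F] --> enorm x.
Proof.
move=> fx; apply: (cvg_comp (fun t => dot (f t) (f t)) Num.sqrt _ (@sqrt_continuous R _)).
exact: cvg_dot.
Qed.

Lemma closed_eqfun (T : topologicalType) (f g : T -> R) :
  continuous f -> continuous g -> closed [set x | f x = g x].
Proof.
move=> cf cg.
have -> : [set x | f x = g x] = (f \- g) @^-1` [set 0].
  by rewrite predeqE => x; split=> /= [->|/eqP]; rewrite ?subrr // subr_eq0 => /eqP.
apply: closed_comp => [x _|]; first by apply: cvgB; [exact: cf | exact: cg].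
exact/accessible_closed_set1/hausdorff_accessible/Rhausdorff.
Qed.

Lemma continuous_qf n (x : 'rV[R]_n) : continuous (fun G : 'M[R]_n => qf G x).
Proof. by move=> G; apply: (@cvg_qf _ (nbhs G)); [exact: cvg_id | exact: cvg_cst]. Qed.

Lemma continuous_enorm n : continuous (@enorm R n).
Proof. by move=> x; apply: (@cvg_enorm _ (nbhs x)); exact: cvg_id. Qed.

Lemma closed_symmetric n : closed [set G : 'M[R]_n | G^T = G].
Proof.
have -> : [set G : 'M[R]_n | G^T = G] =
    \bigcap_(k in [set: 'I_n * 'I_n]) [set G | G k.1 k.2 = G k.2 k.1].
  rewrite predeqE => G; split=> [sG [i j] _ /=|sG]; first by rewrite -{1}sG mxE.
  by apply/matrixP => i j; rewrite mxE; apply: (sG (j, i)).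
by apply: closed_bigI => k _; apply: closed_eqfun; exact: coord_continuous.
Qed.

Lemma closed_psd n : closed (psd R n).
Proof.
have -> : psd R n = [set G | G^T = G] `&`
    \bigcap_(x in [set: 'rV[R]_n]) [set G | 0 <= qf G x].
  rewrite predeqE => G; split=> -[sG pG]; split=> // x.
    by move=> _; exact: pG.
  exact: pG.
apply: closedI; first exact: closed_symmetric.
apply: closed_bigI => x _.
apply: (@closed_comp _ _ (fun G : 'M[R]_n => qf G x) [set y | 0 <= y]).
  by move=> G _; exact: continuous_qf.
exact: closed_ge.
Qed.

(** [K] is a closed subset of the image of a compact box of row vectors under [vec_mx]. *)
Lemma mx_compact m n (K : set 'M[R]_(m, n)) (b : R) :
  closed K -> (forall G i j, K G -> `|G i j| <= b) -> compact K.
Proof.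
move=> cK bK.
have cB : compact [set v : 'rV[R]_(m * n) | forall i, (`[- b, b]%classic) (v ord0 i)].
  by apply: (@rV_compact _ _ (fun=> `[- b, b]%classic)) => _; exact: segment_compact.
apply: subclosed_compact cK (continuous_compact (f := vec_mx) _ cB) _.
  apply: continuous_subspaceT => v; apply: (@cvg_mx _ (nbhs v)) => i j.
  rewrite mxE; under eq_fun do rewrite mxE; exact: coord_continuous.
move=> G KG; exists (mxvec G); last exact: mxvecK.
move=> k; case/mxvec_indexP: k => i j.
by rewrite /= mxvecE in_itv /= -ler_norml bK.
Qed.

(* By compactness of the unit sphere, the form stays positive on it when its
   matrix is perturbed. *)
Lemma posdef_nbhs n (G : 'M[R]_n) : posdef G ->
  \forall H \near G, H^T = H -> posdef H.
Proof.
move=> [sG pG].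
have cB : compact [set x : 'rV[R]_n | enorm x = 1].
  apply: (@mx_compact _ _ _ 1).
    by apply: closed_eqfun; [exact: continuous_enorm | exact: cst_continuous].
  move=> x i j /= x1; rewrite ord1 -(@ler_pXn2r _ 2) ?nnegrE // expr1n.
  have /enorm_eq : enorm x = enorm (const_mx 1 : 'rV[R]_1).
    by rewrite x1 /enorm /dot big_ord1 !mxE mulr1 sqrtr1.
  rewrite [RHS]/dot big_ord1 !mxE mulr1 => <-.
  rewrite real_normK ?num_real // /dot (bigD1 j) //= expr2 lerDl.
  by apply: sumr_ge0 => k _; rewrite -expr2 sqr_ge0.
have /compact_near_coveringP := cB.
move=> /(_ _ (nbhs G) (fun H x => 0 < qf H x)) [].
  move=> x x1.
  have x0 : x != 0 by rewrite -enorm_gt0 x1.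
  have c : qf z.2 z.1 @[z --> (x, G)] --> qf G x.
    by apply: cvg_qf; [exact: cvg_snd | exact: cvg_fst].
  have : nbhs (qf G x) [set y | 0 < y].
    by apply: open_nbhs_nbhs; split; [exact: open_gt | exact: pG].
  by move=> /c.
move=> P nP PG; near=> H => sH; split=> // x x0.
have HP : forall z, enorm z = 1 -> 0 < qf H z.
  by apply: PG; near: H; exists P.
have e0 : 0 < enorm x by rewrite enorm_gt0.
rewrite -/(qf _ _) -(@pmulr_rgt0 _ ((enorm x)^-1 ^+ 2)) ?exprn_gt0 ?invr_gt0 //.
rewrite -qf_scale; apply: HP.
by rewrite enormZ gtr0_norm ?invr_gt0 // mulVf // gt_eqF.
Unshelve. all: by end_near. Qed.

(** Completing the square: among vectors with tail [x], the vector [z] below minimises the form of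
    [Q], and the minimum is the value of the Schur complement at [x]. *)
Lemma schur_posdef n (Q : 'M[R]_(1 + n)) : posdef Q ->
  0 < Q 0 0 /\
  posdef (drsubmx Q - (Q 0 0)^-1 *: (dlsubmx Q *m ursubmx Q)).
Proof.
move=> [sQ pQ].
have a0 : 0 < Q 0 0.
  rewrite -qf_delta; apply: pQ; apply/eqP => /matrixP /(_ 0 0).
  by rewrite !mxE !eqxx => /eqP; rewrite oner_eq0.
have sb : dlsubmx Q = (ursubmx Q)^T by rewrite trmx_ursub sQ.
have sC : (drsubmx Q)^T = drsubmx Q by rewrite trmx_drsub sQ.
split=> //; split=> [|x x0].
  by rewrite linearB linearZ /= trmx_mul sb trmxK sC.
set a := Q 0 0; set b := ursubmx Q; set C := drsubmx Q.
pose z : 'rV_(1 + n) := row_mx (- a^-1 *: (x *m b^T)) x.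
have z0 : z != 0.
  by apply: contra x0 => /eqP; rewrite -(row_mx0 R 1 1 n) => /eq_row_mx [_ ->].
rewrite -/(qf _ _).
suff <- : qf Q z = qf (C - a^-1 *: (dlsubmx Q *m b)) x by exact: pQ.
have QE : Q = block_mx a%:M b b^T C.
  rewrite -sb -[LHS]submxK; congr block_mx.
  by rewrite [LHS]mx11_scalar !mxE; congr (Q _ _)%:M; apply/val_inj.
rewrite /qf sb -/b QE mul_row_block mul_mx_scalar scalerA mulrN mulfV ?gt_eqF //.
rewrite scaleN1r addNr tr_row_mx mul_row_col mul0mx add0r.
by rewrite mulmxBr addrC -scalemxAl -scalemxAr scaleNr mulmxA.
Qed.

Lemma cvg_block_mx (T : Type) (F : set_system T) {FF : Filter F} m n p q
    (f : T -> 'M[R]_(m, n)) (g : T -> 'M[R]_(m, p))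
    (h : T -> 'M[R]_(q, n)) (k : T -> 'M[R]_(q, p))
    (A : 'M[R]_(m, n)) (B : 'M[R]_(m, p)) (C : 'M[R]_(q, n)) (D : 'M[R]_(q, p)) :
  f @ F --> A -> g @ F --> B -> h @ F --> C -> k @ F --> D ->
  block_mx (f t) (g t) (h t) (k t) @[t --> F] --> block_mx A B C D.
Proof.
move=> fA gB hC kD; apply: cvg_mx => i j.
rewrite mxE; under eq_fun do rewrite mxE.
by case: (fintype.split i) => i'; rewrite mxE; under eq_fun do rewrite mxE;
  case: (fintype.split j) => j'; exact: cvg_coord.
Qed.

(** The factor is built recursively from the Schur complement. It is a total function, and its
    continuity at a positive definite [Q] is with respect to all nearby matrices, so that no
    subspace topology enters. *)
Lemma cholesky n : exists c : 'M[R]_n -> 'M[R]_n, forall Q, posdef Q ->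
  c Q *m (c Q)^T = Q /\ c @ Q --> c Q.
Proof.
elim: n => [|n [c cP]].
  exists id => Q _; split; last exact: cvg_id.
  by rewrite [LHS]flatmx0 [RHS]flatmx0.
pose sc (Q : 'M[R]_(1 + n)) := drsubmx Q - (Q 0 0)^-1 *: (dlsubmx Q *m ursubmx Q).
(* Lower block triangular: the first column is that of [Q] divided by the root of its corner, and
   the remaining block factors the Schur complement. *)
exists (fun Q : 'M[R]_(1 + n) => block_mx (Num.sqrt (Q 0 0))%:M 0
  ((Num.sqrt (Q 0 0))^-1 *: dlsubmx Q) (c (sc Q))) => /= Q; change 'M[R]_(1 + n) in Q => pQ.
have [a0 pS] := schur_posdef pQ; have [cS cc] := cP _ pS.
have sb : dlsubmx Q = (ursubmx Q)^T by rewrite trmx_ursub (proj1 pQ).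
set a := Q 0 0 in a0 *; set r := Num.sqrt a.
have r0 : r != 0 by rewrite sqrtr_eq0 -ltNge.
have rr : r * r = a by rewrite -expr2 sqr_sqrtr // ltW.
split.
  rewrite (@tr_block_mx _ 1 n 1 n) (@mulmx_block _ 1 n 1 n 1 n) !trmx0 !mulmx0 !mul0mx
    !addr0 !tr_scalar_mx.
  rewrite -scalar_mxM rr linearZ /= sb trmxK mul_scalar_mx scalerA mulfV //.
  rewrite scale1r mul_mx_scalar scalerA mulfV // scale1r cS.
  rewrite -scalemxAl -scalemxAr scalerA -invfM rr -sb addrC subrK.
  have -> : a%:M = ulsubmx Q.
    by rewrite [RHS]mx11_scalar !mxE; congr (Q _ _)%:M; apply/val_inj.
  exact: (@submxK _ 1 n 1 n Q).
have cQ i j : (fun X : 'M[R]_(1 + n) => X i j) @ Q --> Q i j by exact: coord_continuous.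
have cr : (fun X : 'M[R]_(1 + n) => Num.sqrt (X 0 0)) @ Q --> r.
  exact: (cvg_comp (fun X : 'M[R]_(1 + n) => X 0 0) Num.sqrt (cQ 0 0) (@sqrt_continuous R _)).
have cdl : dlsubmx X @[X --> Q] --> dlsubmx Q.
  apply: (@cvg_mx _ (nbhs Q)) => i j; rewrite !mxE; under eq_fun do rewrite !mxE.
  exact: cQ.
have cur : ursubmx X @[X --> Q] --> ursubmx Q.
  apply: (@cvg_mx _ (nbhs Q)) => i j; rewrite !mxE; under eq_fun do rewrite !mxE.
  exact: cQ.
have cdr : drsubmx X @[X --> Q] --> drsubmx Q.
  apply: (@cvg_mx _ (nbhs Q)) => i j; rewrite !mxE; under eq_fun do rewrite !mxE.
  exact: cQ.
apply: (@cvg_block_mx _ (nbhs Q) _ 1 1 n n).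
- apply: (@cvg_mx _ (nbhs Q)) => i j; rewrite !mxE; under eq_fun do rewrite !mxE.
  by rewrite !ord1; exact: cr.
- exact: cvg_cst.
- by apply: cvgZ cdl; apply: cvgV.
- apply: (cvg_comp sc c _ cc); apply: cvgB cdr _; apply: cvgZ.
    by apply: cvgV; [rewrite gt_eqF | exact: cQ].
  exact: cvg_mulmx.
Qed.

End Forms.

(** * Recovering the edge vectors from a singular Gram matrix *)

Section GramFactorization.
Variables (R : realType) (d : nat).

(* Left multiplication by [rowdiffmx] turns the rows v_0, ..., v_d into
   v_1 - v_0, ..., v_d - v_0; left multiplication by [tailmx] puts a zero row
   on top. *)
Definition rowdiffmx : 'M[R]_(d, d.+1) :=
  \matrix_(j, i) ((i == lift ord0 j)%:R - (i == ord0)%:R).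

Definition tailmx : 'M[R]_(d.+1, d) := \matrix_(i, j) (i == lift ord0 j)%:R.

Lemma row_rowdiffmx j : row j rowdiffmx = delta_mx 0 (lift ord0 j) - delta_mx 0 ord0.
Proof. by apply/rowP => i; rewrite !mxE eqxx. Qed.

Lemma row_rowdiffmx_mul n (V : 'M[R]_(d.+1, n)) j :
  row j (rowdiffmx *m V) = row (lift ord0 j) V - row ord0 V.
Proof. by rewrite row_mul row_rowdiffmx mulmxBl -!rowE. Qed.

Lemma rowdiffmx_mulE n (V : 'M[R]_(d.+1, n)) j k :
  (rowdiffmx *m V) j k = V (lift ord0 j) k - V ord0 k.
Proof. by have /rowP/(_ k) := row_rowdiffmx_mul V j; rewrite [LHS]mxE => ->; rewrite !mxE. Qed.

Lemma row0_tailmx : row ord0 tailmx = 0.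
Proof. by apply/rowP => j; rewrite !mxE. Qed.

Lemma row_tailmx j : row (lift ord0 j) tailmx = delta_mx 0 j.
Proof. by apply/rowP => i; rewrite !mxE (inj_eq lift_inj) eqxx eq_sym. Qed.

(** This is the identity v_i = v_0 + (v_i - v_0) in matrix form. *)
Lemma split1mx :
  (const_mx 1 : 'cV[R]_d.+1) *m delta_mx 0 ord0 + tailmx *m rowdiffmx = 1%:M.
Proof.
apply/row_matrixP => i; rewrite linearD /= !row_mul row_const.
have -> : (const_mx 1 : 'rV[R]_1) = 1%:M by apply/rowP => j; rewrite !mxE ord1.
rewrite mul1mx row1; case: (unliftP ord0 i) => [j ->|->].
  by rewrite row_tailmx -rowE row_rowdiffmx addrC subrK.
by rewrite row0_tailmx mul0mx addr0.
Qed.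

Lemma period_gramE (G : 'M[R]_d.+1) : period_gram G = rowdiffmx *m G *m rowdiffmx^T.
Proof.
apply/matrixP => i j.
have -> : (rowdiffmx *m G *m rowdiffmx^T) i j = (rowdiffmx *m (rowdiffmx *m G)^T) j i.
  by rewrite -[rowdiffmx *m G *m _]trmxK trmx_mul trmxK mxE.
rewrite rowdiffmx_mulE [LHS]mxE [X in _ = X - _]mxE [X in _ = _ - X]mxE !rowdiffmx_mulE.
ring.
Qed.

Lemma continuous_period_gram : continuous (@period_gram R d).
Proof.
have -> : @period_gram R d = fun G => rowdiffmx *m G *m rowdiffmx^T.
  by apply/funext => G; exact: period_gramE.
move=> G; apply: (@cvg_mulmx _ (nbhs G)); last exact: cvg_cst.
by apply: (@cvg_mulmx _ (nbhs G)); [exact: cvg_cst | exact: cvg_id].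
Qed.

(** The rows of [M] serve as the differences v_j - v_0. Their inner products with v_0 can be read
    off [G], which determines v_0; a kernel vector of [G] ensures that the resulting vectors have
    Gram matrix [G] and not merely the right differences. *)
Lemma gram_factor (G : 'M[R]_d.+1) (M : 'M[R]_d) :
  psd R d.+1 G -> ~ posdef G -> M \in unitmx -> period_gram G = M *m M^T ->
  let V := const_mx 1 *m (row ord0 G *m rowdiffmx^T *m (invmx M)^T) + tailmx *m M in
  V *m V^T = G.
Proof.
move=> pG nG uM GM V; have [z z0 zG] := not_posdef pG nG.
rewrite period_gramE in GM.
pose w := z *m tailmx; pose s := (z *m (const_mx 1 : 'cV[R]_d.+1)) 0 0.
have zE : z = s *: delta_mx 0 ord0 + w *m rowdiffmx.
  rewrite -[LHS]mulmx1 -split1mx mulmxDr !mulmxA -/w; congr (_ + _).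
  by rewrite [z *m const_mx 1]mx11_scalar mul_scalar_mx.
(* If the coordinates of [z] summed to zero, [z] would be a relation among the differences alone,
   whose Gram matrix is invertible. *)
have s0 : s != 0.
  apply: contra z0 => /eqP s0; rewrite s0 scale0r add0r in zE.
  suff w0 : w = 0 by rewrite zE w0 mul0mx.
  have : w *m (M *m M^T) = 0 by rewrite -GM !mulmxA -zE zG mul0mx.
  move/(congr1 (mulmx^~ (invmx (M *m M^T)))); rewrite mulmxK ?mul0mx //.
  by rewrite unitmx_mul unitmx_tr uM.
(* Solved for v_0, the kernel relation gives it as the combination [c] of the differences; the rows
   of [K] then express every v_i through them. *)
pose c := - s^-1 *: w; pose K := const_mx 1 *m c + tailmx.
have KG : K *m rowdiffmx *m G = G.
  apply/eqP; rewrite -subr_eq0 -{2}[G]mul1mx -mulmxBl -split1mx /K mulmxDl opprD.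
  rewrite addrACA subrr addr0 -mulmxA -mulmxBr.
  suff -> : c *m rowdiffmx - delta_mx 0 ord0 = - s^-1 *: z.
    by rewrite -mulmxA -scalemxAl zG scaler0 mulmx0.
  rewrite zE scalerDr -scalemxAl scalerA mulNr mulVf // scaleN1r addrC.
  by rewrite scalemxAl.
have GK : G = K *m M *m (K *m M)^T.
  rewrite trmx_mul mulmxA -[K *m M *m _]mulmxA -GM.
  have GK : G *m rowdiffmx^T *m K^T = G.
    by rewrite -{1}(proj1 pG) -mulmxA -!trmx_mul KG (proj1 pG).
  by rewrite -!mulmxA (mulmxA G) GK mulmxA KG.
suff VK : V = K *m M by rewrite VK -GK.
have -> : K *m M = const_mx 1 *m (c *m M) + tailmx *m M by rewrite mulmxDl mulmxA.
rewrite /V; congr (_ *m _ + _).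
have -> : row ord0 G = c *m rowdiffmx *m G.
  rewrite -{1}KG -mulmxA row_mul linearD /= row_mul row_const row0_tailmx addr0.
  have -> : (const_mx 1 : 'rV[R]_1) = 1%:M by apply/rowP => j; rewrite !mxE ord1.
  by rewrite mul1mx mulmxA.
by rewrite trmx_inv -(mulmxA c rowdiffmx) -(mulmxA c) GM mulmxA mulmxK ?unitmx_tr.
Qed.

End GramFactorization.

Arguments rowdiffmx {R d}.
Arguments tailmx {R d}.

(** * Compact homeomorphisms, bases of subspaces, relative boundaries *)

(* A bijection that is continuous on a compact set is closed there, so its
   inverse is continuous. *)
Lemma compact_homeomorphic (X Y : topologicalType) (A : set X) (B : set Y)
    (f : X -> Y) (g : Y -> X) :
  hausdorff_space Y -> compact A -> {within A, continuous f} ->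
  (forall x, A x -> B (f x)) -> (forall y, B y -> A (g y)) ->
  (forall x, A x -> g (f x) = x) -> (forall y, B y -> f (g y) = y) ->
  homeomorphic A B.
Proof.
move=> hY cA cf fB gA fK gK.
pose f' (x : A) : B := exist _ (f (val x)) (mem_set (fB _ (set_mem (valP x)))).
pose g' (y : B) : A := exist _ (g (val y)) (mem_set (gA _ (set_mem (valP y)))).
exists f', g'; split.
- apply: continuous_comp_initial.
  exact: (proj1 (subspace_sigL_continuousP A f) cf).
- apply/continuousP => C [W oW WC].
  exists (~` (f @` (A `\` W))).
    apply: closed_openC; apply: (compact_closed hY).
    apply: continuous_compact.
      exact: (continuous_subspaceW (@subDsetl _ A W) cf).
    by rewrite setDE; apply: compact_closedI => //; exact: open_closedC.
  rewrite -WC predeqE => y; split => /= h.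
    apply: contrapT => nW; apply: h; exists (g (val y)); last exact: gK (set_mem (valP y)).
    by split => //; exact: gA (set_mem (valP y)).
  by move=> [x [Ax nW] xy]; apply: nW; rewrite -(fK _ Ax) xy.
- by move=> x; apply/val_inj => /=; apply: fK; exact: (set_mem (valP x)).
- by move=> y; apply/val_inj => /=; apply: gK; exact: (set_mem (valP y)).
Qed.

(** A free family in [L] of maximal size spans [L], since a vector of [L] outside its span could be
    appended. *)
Lemma subspace_row_basis (K : fieldType) m (L : set 'rV[K]_m) :
  L 0 -> (forall t x y, L x -> L y -> L (t *: x + y)) ->
  exists N (B : 'M[K]_(N, m)), row_free B /\ forall v, L v <-> (v <= B)%MS.
Proof.
move=> L0 Llin.
pose P k := `[< exists B : 'M[K]_(k, m), row_free B /\ forall i, L (row i B) >].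
have P0 : exists k, P k.
  exists 0%N; apply/asboolP; exists 0; split; last by case.
  by rewrite /row_free mxrank0.
have Pm k : P k -> (k <= m)%N.
  by move=> /asboolP[B [/eqP fB _]]; rewrite -fB; exact: rank_leq_col.
case: (ex_maxnP P0 Pm) => N /asboolP[B [fB LB]] maxN.
exists N, B; split=> // v; split=> [Lv|/submxP[w ->]]; last first.
  rewrite mulmx_sum_row; elim: (index_enum _) => [|i r IH].
    by rewrite big_nil.
  by rewrite big_cons; apply: Llin.
apply: contraT => nv; suff /maxN : P (N + 1)%N by rewrite addn1 ltnn.
apply/asboolP; exists (col_mx B v); split.
  rewrite /row_free eqn_leq rank_leq_row -addsmxE /=.
  apply: (@leq_trans (\rank B).+1); first by rewrite (eqP fB) addn1.
  apply: rank_ltmx; rewrite /ltmx addsmxSl /=.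
  by apply: contra nv; apply: submx_trans; exact: addsmxSr.
move=> i; case: (fintype.splitP i) => j ij.
  have -> : i = lshift 1 j by exact/val_inj.
  by rewrite rowKu.
have -> : i = rshift N j by exact/val_inj.
rewrite rowKd; congr (L _): Lv.
by apply/rowP => k; rewrite mxE ord1.
Qed.

Lemma boundary_in_closed (X : topologicalType) (A S : set X) :
  closed S -> S `<=` A -> boundary_in A S = S `&` closure (A `\` S).
Proof.
move=> cS SA; rewrite /boundary_in -(closure_id S).1 //; congr (_ `&` _).
by rewrite setIC; exact: setIidl.
Qed.

(** * Affine slices of the semidefinite cone and their boundary spheres *)

Section Slices.
Variables (R : realType) (n : nat) (A : set 'M[R]_n).
Hypothesis affA : affine_subspace A.
Local Notation S := (psd R n `&` A).
Variable G1 : 'M[R]_n.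
Hypotheses (AG1 : A G1) (pG1 : posdef G1).

(** Definiteness persists under small symmetric perturbations, so definite points are interior. A
    singular point is left by prolonging the segment from [G1] slightly beyond it. *)
Lemma boundary_in_slice : closed S ->
  boundary_in A S = [set G | S G /\ ~ posdef G].
Proof.
move=> cS; rewrite predeqE => G; split.
  move=> [[AG cG] dG]; have SG : S G by rewrite closure_id in cS; rewrite cS.
  split=> // pG; have [H [[AH nSH] pH]] := dG _ (posdef_nbhs pG).
  by apply: nSH; split => //; apply/posdef_psd/pH; exact: (proj1 affA).
move=> [[pG AG] nG]; split; first by split=> //; exact: subset_closure.
have [x x0 xG] := not_posdef pG nG.
(* For t > 0 this point lies beyond [G] as seen from [G1], and its form is negative at the kernel
   vector [x]. *)
pose H (t : R) := (1 - (- t)) *: G + (- t) *: G1.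
have H0 : H 0 = G by rewrite /H oppr0 subr0 scale1r scale0r addr0.
have cH : H t @[t --> (0 : R)] --> G.
  rewrite -{1}H0 /H; apply: cvgD; apply: cvgZ; try exact: cvg_cst.
    by apply: cvgB; [exact: cvg_cst | apply: cvgN; exact: cvg_id].
  by apply: cvgN; exact: cvg_id.
move=> U /cH; rewrite nbhs_simpl /= => /nbhs_ballP[e e0 eU].
exists (H (e / 2)); split; last first.
  apply: eU; rewrite /ball /= sub0r normrN gtr0_norm ?divr_gt0 //.
  by rewrite ltr_pdivrMr // ltr_pMr // ltr1n.
split; first exact: (proj2 affA).
move=> [[_ /(_ x)]] + _; apply/negP; rewrite -ltNge -/(qf _ _) qfD !qfZ.
have -> : qf G x = 0 by rewrite qfE xG dotE mul0mx mxE.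
by rewrite mulr0 add0r mulNr oppr_lt0 mulr_gt0 ?divr_gt0 //; exact: (proj2 pG1).
Qed.

Lemma slice_direction_linear (t : R) v w :
  A (G1 + v) -> A (G1 + w) -> A (G1 + (t *: v + w)).
Proof.
move=> Av Aw; have [_ aff] := affA.
have Atv : A (G1 + t *: v).
  by have := aff t _ _ AG1 Av; rewrite scalerDr addrA -scalerDl subrK scale1r.
(* The sum of two directions is twice their midpoint, measured from [G1]. *)
have := aff 2 _ _ AG1 (aff 2^-1 _ _ Atv Aw); congr A.
by apply/matrixP => i j; rewrite !mxE; field.
Qed.

(** Radial projection from [G1], in linear coordinates of the affine subspace centred there. The
    second point [G2] makes the dimension positive; it is written N + 1, to match the index of
    [sphere]. *)
Lemma slice_boundary_sphere G2 : A G2 -> G2 != G1 -> compact S ->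
  exists N : nat, homeomorphic (boundary_in A S) (sphere R N).
Proof.
move=> AG2 G21 kS.
have hM : hausdorff_space 'M[R]_n by exact: norm_hausdorff.
have cS : closed S by exact: compact_closed.
rewrite boundary_in_slice //.
pose L := [set v : 'rV[R]_(n * n) | A (G1 + vec_mx v)].
have [||[|N] [B [fB LB]]] := @subspace_row_basis _ _ L.
- by rewrite /L /= linear0 addr0.
- by move=> t x y Lx Ly; rewrite /L /= linearP; exact: slice_direction_linear.
- have : L (mxvec (G2 - G1)) by rewrite /L /= mxvecK addrC subrK.
  move=> /LB /submxP[w]; rewrite (thinmx0 w) mul0mx => /(congr1 vec_mx).
  by rewrite mxvecK linear0 => /eqP; rewrite subr_eq0 (negbTE G21).
exists N.
(* [co] gives the coordinates of a point of [A] with origin [G1], and [ray] is the inverse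
   parametrisation. *)
pose co (G : 'M[R]_n) := mxvec (G - G1) *m pinvmx B.
pose ray (y : 'rV[R]_N.+1) := G1 + vec_mx (y *m B).
have coK G : A G -> ray (co G) = G.
  move=> AG; rewrite /ray /co mulmxKpV; first by rewrite mxvecK addrC subrK.
  by apply/LB; rewrite /L /= mxvecK addrC subrK.
have rayK y : co (ray y) = y.
  by rewrite /co /ray addrAC subrr add0r vec_mxK mulmxKp.
have Aray y : A (ray y) by apply/LB; exact: submxMl.
have cco : continuous co.
  move=> G; apply: (@cvg_mulmx _ (nbhs G)); last exact: cvg_cst.
  apply: (@cvg_mx _ (nbhs G)) => i k; case/mxvec_indexP: k => k l.
  rewrite ord1 mxvecE !mxE; under eq_fun do rewrite mxvecE !mxE.
  by apply: cvgB; [exact: coord_continuous | exact: cvg_cst].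
have rayZ t y : ray (t *: y) = (1 - t) *: G1 + t *: ray y.
  rewrite /ray -scalemxAl linearZ /= scalerDr addrA -scalerDl subrK scale1r //.
have ray0 : ray 0 = G1 by rewrite /ray mul0mx linear0 addr0.
pose f (G : 'M[R]_n) := (enorm (co G))^-1 *: co G.
pose bS := [set G | S G /\ ~ posdef G].
have co_neq0 G : bS G -> 0 < enorm (co G).
  move=> [[_ AG] nG]; rewrite enorm_gt0; apply/eqP => c0.
  by apply: nG; rewrite -(coK G AG) c0 ray0.
(* Of two distinct points on one half-line from [G1], the nearer would be positive definite by
   convexity. *)
have f_inj_lt G H r : bS G -> bS H -> 0 <= r -> r < 1 -> co G = r *: co H -> False.
  move=> [[_ AG] nG] [[pH AH] nH] r0 r1 GH; apply: nG.
  rewrite -(coK _ AG) GH rayZ coK //.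
  exact: posdef_convex.
have f_inj G H : bS G -> bS H -> f G = f H -> G = H.
  move=> bG bH; have eG := co_neq0 _ bG; have eH := co_neq0 _ bH => fGH.
  have GH : co G = (enorm (co G) / enorm (co H)) *: co H.
    by rewrite -scalerA -/(f H) -fGH scalerA mulfV ?gt_eqF // scale1r.
  have HG : co H = (enorm (co H) / enorm (co G)) *: co G.
    by rewrite -scalerA -/(f G) fGH scalerA mulfV ?gt_eqF // scale1r.
  have [lt|lt|eq] := ltgtP (enorm (co G)) (enorm (co H)).
  - case: (f_inj_lt _ _ _ bG bH _ _ GH); first by rewrite divr_ge0 ?ltW.
    by rewrite ltr_pdivrMr // mul1r.
  - case: (f_inj_lt _ _ _ bH bG _ _ HG); first by rewrite divr_ge0 ?ltW.
    by rewrite ltr_pdivrMr // mul1r.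
  - have [[[_ AG] _] [[_ AH] _]] := (bG, bH).
    by rewrite -(coK _ AG) -(coK _ AH) GH eq mulfV ?gt_eqF // scale1r.
have f_surj s : enorm s = 1 -> exists2 G, bS G & f G = s.
  move=> s1.
  have ss : dot s s = 1 by rewrite -enorm_sqr s1 expr1n.
  pose phi (G : 'M[R]_n) := dot (co G) s.
  have cphi : continuous phi.
    move=> G; apply: (@cvg_dot _ _ (nbhs G)); last exact: cvg_cst.
    exact: cco.
  (* [K] is the part of the half-line in direction [s] inside the slice, with [phi] as its
     parameter. By compactness it has a farthest point. *)
  pose K := S `&` ([set G | 0 <= phi G] `&` [set G | co G = phi G *: s]).
  have kK : compact K.
    apply: compact_closedI => //; apply: closedI.
      by apply: (@closed_comp _ _ phi [set x | 0 <= x]) => [x _|];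
        [exact: cphi | exact: closed_ge].
    have -> : [set G | co G = phi G *: s] =
        \bigcap_(i in [set: 'I_N.+1]) [set G | co G 0 i = phi G * s 0 i].
      rewrite predeqE => G; split=> /= [h i _|h]; first by rewrite /= {1}h mxE.
      by apply/rowP => i; rewrite [RHS]mxE; exact: (h i).
    apply: closed_bigI => i _; apply: closed_eqfun => G.
      by apply: (@cvg_coord _ (nbhs G)); exact: cco.
    by apply: (@continuousM _ _ phi (fun=> s 0 i)); [exact: cphi | exact: cst_continuous].
  have K0 : K G1.
    have coG1 : co G1 = 0 by rewrite -ray0 rayK.
    have phi0 : phi G1 = 0 by rewrite /phi coG1 dotE mul0mx mxE.
    split; first by split => //; exact: posdef_psd.
    by split; rewrite /= phi0 // coG1 scale0r.
  have [G /set_mem[SG [/= p0 coG]] maxG] := compact_EVT_max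
    (ex_intro _ _ K0) kK (continuous_subspaceT cphi).
  (* At a positive definite point one could move on by [e / 2] and stay in [K]. *)
  have nG : ~ posdef G.
    move=> pG; pose H (t : R) := ray ((phi G + t) *: s).
    have H0 : H 0 = G by rewrite /H addr0 -coG coK //; case: SG.
    have cH : H t @[t --> (0 : R)] --> G.
      rewrite -{1}H0 /H; apply: (@cvgD _ _ _ (nbhs (0:R))); first exact: cvg_cst.
      apply: (@cvg_mx _ (nbhs (0:R))) => i j; rewrite mxE; under eq_fun do rewrite mxE.
      apply: (@cvg_coord _ (nbhs (0:R))); apply: (@cvg_mulmx _ (nbhs (0:R))); last exact: cvg_cst.
      apply: cvgZ; last exact: cvg_cst.
      by apply: cvgD; [exact: cvg_cst | exact: cvg_id].
    have /cH := posdef_nbhs pG; rewrite nbhs_simpl /= => /nbhs_ballP[e e0 eU].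
    have pH : posdef (H (e / 2)).
      apply: eU; last by apply: (proj1 affA); exact: Aray.
      rewrite /ball /= sub0r normrN gtr0_norm ?divr_gt0 //.
      by rewrite ltr_pdivrMr // ltr_pMr // ltr1n.
    have phiH : phi (H (e / 2)) = phi G + e / 2.
      by rewrite {1}/phi /H rayK dotZl ss mulr1.
    have KH : K (H (e / 2)).
      split; first by split; [exact: posdef_psd | exact: Aray].
      split; rewrite /= phiH; first by rewrite addr_ge0 // ltW ?divr_gt0.
      by rewrite /H rayK.
    have := maxG _ (mem_set KH); rewrite phiH; apply/negP; rewrite -ltNge.
    by rewrite ltrDl divr_gt0.
  exists G; first by [].
  have := co_neq0 G (conj SG nG); rewrite /f coG enormZ s1 mulr1 ger0_norm //.
  by move=> p1; rewrite scalerA mulVf ?gt_eqF // scale1r.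
have /choice[g gP] : forall s : 'rV[R]_N.+1, exists G : 'M[R]_n,
    enorm s = 1 -> bS G /\ f G = s.
  move=> s.
  (* Off the unit sphere the value 0 is an arbitrary default. *)
  have [s1|s1] := pselect (enorm s = 1); last by exists 0.
  by have [G bG fG] := f_surj s s1; exists G.
have fS G : bS G -> enorm (f G) = 1.
  move=> /co_neq0 c0; rewrite /f enormZ gtr0_norm ?invr_gt0 //.
  by rewrite mulVf // gt_eqF.
apply: (@compact_homeomorphic _ _ _ _ f g).
- exact: norm_hausdorff.
- rewrite -/bS /bS -boundary_in_slice // boundary_in_closed //.
  by apply: compact_closedI => //; exact: closed_closure.
- move=> /= ; apply: continuous_in_subspaceT => G /set_mem /co_neq0 c0.
  apply: (cvgZ (F := nbhs G)); last exact: cco.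
  apply: (cvgV (F := nbhs G)); first by rewrite gt_eqF.
  by apply: (@cvg_enorm _ _ (nbhs G)); exact: cco.
- exact: fS.
- by move=> s /gP[].
- by move=> G bG; have [bg fg] := gP _ (fS _ bG); exact: f_inj.
- by move=> s /gP[].
Qed.

End Slices.

(** * The topology of pointwise convergence *)

Section Pointwise.
Context {I : Type} {U : topologicalType}.

Lemma ptws_eval_continuous (i : I) : continuous (fun f : {ptws I -> U} => f i).
Proof.
move=> f.
have : nbhs f --> f by [].
move=> /cvg_sup /(_ i) h W nW.
exact: (h _ (@initial_continuous _ _ (fun f : I -> U => f i) f W nW)).
Qed.

(** The topology is the supremum of those induced by the evaluations, so convergence can be tested
    at one index at a time. *)
Lemma cvg_ptws (T : Type) (F : set_system T) {FF : Filter F}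
    (h : T -> {ptws I -> U}) (f : {ptws I -> U}) :
  (forall i, h t i @[t --> F] --> f i) -> h @ F --> f.
Proof.
move=> hf; apply/cvg_sup => i A [_ [[W oW <-] /= Wf] WA].
have := hf i W (open_nbhs_nbhs (conj oW Wf)).
by apply: (@filterS _ F) => t Wt; exact: WA.
Qed.

End Pointwise.

(** * Additive maps between abelian groups *)

Section Additive.
Variables (U V : zmodType) (f : U -> V).
Hypothesis fD : forall g h, f (g + h) = f g + f h.

Lemma hom0 : f 0 = 0.
Proof. by apply: (addrI (f 0)); rewrite -fD !addr0. Qed.

Lemma homN g : f (- g) = - f g.
Proof. by apply: (addrI (f g)); rewrite -fD !subrr hom0. Qed.

Lemma hom_sum (I : Type) (r : seq I) (F : I -> U) :
  f (\sum_(i <- r) F i) = \sum_(i <- r) f (F i).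
Proof.
by elim: r => [|i r IH]; rewrite ?big_nil ?hom0 // !big_cons fD IH.
Qed.

Lemma homMz g (n : int) : f (g *~ n) = f g *~ n.
Proof.
have nat k : f (g *+ k) = f g *+ k.
  by elim: k => [|k IH]; rewrite ?mulr0n ?hom0 // !mulrS fD IH.
by case: n => k; [exact: nat | rewrite !NegzE !mulrNz homN nat].
Qed.

End Additive.

(** * Vertex orbits and invariance of edge lengths *)

Section Orbits.
Variables (R : realType) (d : nat) (F : periodicFramework R d).
Local Notation V := (vertex (graph F)).
Local Notation e := (@adj d (graph F)).
Local Notation act := (@act d (graph F)).
Implicit Types (v w : V).

Lemma same_orbit_act g v : same_orbit v (act g v).
Proof. by exists g. Qed.

Lemma same_orbit_sym v w : same_orbit v w -> same_orbit w v.
Proof. by move=> [g ->]; exists (- g); rewrite -actD addNr act0. Qed.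

Lemma same_orbit_trans v w z : same_orbit v w -> same_orbit w z -> same_orbit v z.
Proof. by move=> [g ->] [h ->]; exists (h + g); rewrite actD. Qed.

Hypotheses (Forb : two_orbits F) (Fedge : edges_join_orbits F).

Lemma orbit_cases v w : e v w -> forall z, same_orbit v z \/ same_orbit w z.
Proof.
move=> /Fedge vw; have [a [b [_ ab]]] := Forb.
have or (c x y : V) : same_orbit c x -> same_orbit c y -> same_orbit x y.
  by move=> /same_orbit_sym cx; exact: same_orbit_trans cx.
move=> z; case: (ab v) (ab w) (ab z) => av [] aw [] az;
  by [case: vw; exact: or av aw | left; exact: or av az | right; exact: or aw az].
Qed.

Lemma edge_lengthC (x : preplacement R (graph F)) v w :
  edge_length x v w = edge_length x w v.
Proof. by rewrite /edge_length -opprB -scaleN1r enormZ normrN1 mul1r. Qed.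

Lemma edge_length_act (x : preplacement R (graph F)) g v w :
  placement x -> edge_length x (act g v) (act g w) = edge_length x v w.
Proof.
by move=> [_ _ _ xa]; rewrite /edge_length !xa opprD addrACA subrr addr0.
Qed.

End Orbits.

(** * The Gram map on realizations and its injectivity *)

Section Configurations.
Variables (R : realType) (d : nat) (F : periodicFramework R d).
Local Notation V := (vertex (graph F)).
Local Notation e := (@adj d (graph F)).
Local Notation act := (@act d (graph F)).
Local Notation period := (period (graph F)).
Hypotheses (Forb : two_orbits F) (Fedge : edges_join_orbits F).
Variables (u : V) (r : nat) (nb : 'I_(d.+1 + r) -> V) (q : 'M[rat]_(r, d)).
Hypothesis lab : gram_labelling u nb q.

Local Notation p := (place F).1.
Local Notation P := (place F).2.
Local Notation Pl := (placeP F).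
Local Notation preplace := (preplacement R (graph F)).
Local Notation nb0 := (nb (lshift r ord0)).

Lemma adj_nb k : e u (nb k).
Proof.
have [_ nbE _ _] := lab.
by have : range nb (nb k) by []; rewrite nbE.
Qed.

Lemma nb_orbit v : same_orbit u v \/ same_orbit nb0 v.
Proof. exact: (orbit_cases Forb Fedge (adj_nb _)). Qed.

(** No edge stays in an orbit, so all neighbours of [u] lie in the other one and differ by
    periods. *)
Lemma nb_period : exists gk : 'I_(d.+1 + r) -> period, forall k, nb k = act (gk k) nb0.
Proof.
suff /choice[gk gkP] : forall k, exists g, nb k = act g nb0 by exists gk.
move=> k; have [uk|//] := nb_orbit (nb k).
by case: (Fedge (adj_nb k)).
Qed.

Definition edge_mx (x : preplace) : 'M[R]_(d.+1, d) :=
  \matrix_i edge_vector u nb x (lshift r i).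

Definition basis_mx (x : preplace) : 'M[R]_d := \matrix_j basis_vector u nb x j.

Lemma basis_mxE x : basis_mx x = rowdiffmx *m edge_mx x.
Proof.
by apply/row_matrixP => j; rewrite row_rowdiffmx_mul !rowK.
Qed.

Lemma gramE x : gram u nb x = edge_mx x *m (edge_mx x)^T.
Proof.
apply/matrixP => i j; rewrite !mxE; apply: eq_bigr => k _.
by rewrite !mxE.
Qed.

Lemma period_gram_gram x : period_gram (gram u nb x) = basis_mx x *m (basis_mx x)^T.
Proof. by rewrite period_gramE gramE basis_mxE trmx_mul !mulmxA. Qed.

Lemma period_vectorE x gk k : placement x -> (forall k, nb k = act (gk k) nb0) ->
  period_vector u nb x k = x.2 (gk k).
Proof.
move=> [_ _ _ xa] gkP; rewrite /period_vector /edge_vector {1}gkP xa.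
by rewrite (addrAC (x.1 nb0)) [X in X - _]addrC addrK.
Qed.

Lemma basis_mx_place_unit : basis_mx (place F) \in unitmx.
Proof. by case: lab. Qed.

(** The linear map taking the basis period vectors of the given placement to those of [x]; vectors
    being rows, it acts on the right. *)
Definition transfer (x : preplace) := invmx (basis_mx (place F)) *m basis_mx x.

(* The period vectors v_1 - v_0, ..., v_d - v_0 generate a subgroup of finite
   index D of the period group, so that D g is an integral combination of
   them for every period g, in all placements alike. *)
Lemma transferE x g : placement x -> x.2 g = P g *m transfer x.
Proof.
move=> px; have [gk gkP] := nb_period.
have [Pinj PD [B uB PB] _] := Pl; have [_ xD _ _] := px.
pose gj j := gk (lshift r (lift ord0 j)).
have basE y : placement y -> forall j, row j (basis_mx y) = y.2 (gj j).
  by move=> py j; rewrite rowK /basis_vector (period_vectorE _ py gkP).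
have /choice[c cP] : forall h, exists c : 'rV[int]_d, P h = map_mx intr c *m B.
  by move=> h; have : range P (P h) by []; rewrite PB.
pose C : 'M[int]_d := \matrix_j c (gj j).
have MF : basis_mx (place F) = map_mx intr C *m B.
  apply/row_matrixP => j; rewrite basE; last exact: Pl.
  by rewrite cP row_mul -map_row rowK.
pose D := \det C.
have D0 : D%:~R != 0 :> R.
  have := basis_mx_place_unit; rewrite MF unitmx_mul => /andP[uC _].
  by move: uC; rewrite unitmxE det_map_mx unitfE.
(* Cramer's rule: multiplying by the adjugate keeps the coefficients integral, at the cost of the
   factor [D]. *)
pose n := c g *m \adj C.
have Pn : P (g *~ D) = map_mx intr n *m basis_mx (place F).
  rewrite (homMz PD) MF mulmxA -map_mxM /n -mulmxA mul_adj_mx mul_mx_scalar.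
  by rewrite map_mxZ -scalemxAl -cP -scaler_int.
have comb y : placement y -> map_mx intr n *m basis_mx y = y.2 (\sum_j gj j *~ n 0 j).
  move=> py; have [_ yD _ _] := py.
  rewrite (hom_sum yD) mulmx_sum_row; apply: eq_bigr => j _.
  by rewrite basE // mxE (homMz yD) scaler_int.
(* Injectivity of [P] lifts the relation to the period group, whence it holds in the placement [x]
   too. *)
have gD : g *~ D = \sum_j gj j *~ n 0 j.
  by apply: Pinj; rewrite Pn comb //; exact: Pl.
apply: (scalerI D0); rewrite scaler_int -(homMz xD) gD -comb //.
rewrite scalemxAl scaler_int -(homMz PD) Pn /transfer mulmxA mulmxK //.
exact: basis_mx_place_unit.
Qed.

(** A basis of the lattice of [x] consists of periods, hence factors through [transfer x]. *)
Lemma transfer_unit x : placement x -> transfer x \in unitmx.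
Proof.
move=> px; have [_ _ [B uB xB] _] := px.
have /choice[h hP] : forall j, exists g, x.2 g = row j B.
  move=> j; have : range x.2 (row j B).
    rewrite xB; exists (delta_mx 0 j).
    by rewrite map_delta_mx -rowE.
  by case=> g _ <-; exists g.
have BE : B = (\matrix_j P (h j)) *m transfer x.
  by apply/row_matrixP => j; rewrite row_mul rowK -transferE.
by move: uB; rewrite BE unitmx_mul => /andP[].
Qed.

Lemma basis_mx_unit x : placement x -> basis_mx x \in unitmx.
Proof. by move=> /transfer_unit; rewrite unitmx_mul => /andP[]. Qed.

(** The rational relation holds in the given placement by the labelling, and the linear map
    [transfer x] carries it to [x]. *)
Lemma edge_vector_last x k : placement x ->
  edge_vector u nb x (rshift d.+1 k) = edge_coef R q k *m edge_mx x.
Proof.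
move=> px; have [gk gkP] := nb_period; have [_ _ _ qP] := lab.
have := qP k; rewrite (period_vectorE _ Pl gkP) => Pk.
have xk : period_vector u nb x (rshift d.+1 k) =
    (\row_j ratr (q k j)) *m basis_mx x.
  rewrite (period_vectorE _ px gkP) transferE // Pk /transfer mulmxA.
  congr (_ *m _); rewrite -[RHS](mulmxK basis_mx_place_unit); congr (_ *m _).
  rewrite mulmx_sum_row; apply: eq_bigr => j _.
  by rewrite rowK mxE.
have -> : edge_vector u nb x (rshift d.+1 k) =
    edge_vector u nb x (lshift r ord0) + (\row_j ratr (q k j)) *m basis_mx x.
  by rewrite -xk addrC subrK.
rewrite !mulmx_sum_row big_ord_recl rowK mxE unlift_none scalerBl scale1r.
set v0 := edge_vector u nb x (lshift r ord0).
rewrite -[RHS]addrA; congr (v0 + _); rewrite addrC scaler_suml.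
rewrite -sumrB; apply: eq_bigr => j _.
by rewrite !rowK !mxE liftK /basis_vector /period_vector scalerBr.
Qed.

(** The d + 1 rows of the edge matrix are dependent in dimension d, and a relation among them is a
    zero of the form. *)
Lemma gram_not_posdef x : ~ posdef (gram u nb x).
Proof.
move=> [_ pG]; set W := edge_mx x.
have : kermx W != 0.
  by rewrite kermx_eq0 /row_free neq_ltn ltnS rank_leq_col.
rewrite -nz_row_eq0 => /pG; apply/negP; rewrite -leNgt.
have : (nz_row (kermx W) <= kermx W)%MS by exact: nz_row_sub.
by rewrite gramE -/(qf _ _) qf_gram => /sub_kermxP ->; rewrite dotE mul0mx mxE.
Qed.

Lemma gram_affine_gram (x : realization F) : gram_affine u nb q (gram u nb (val x)).
Proof.
have [px xe] : realization F (val x) by exact: set_mem (valP x).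
have xk k : dot (edge_vector u nb (val x) k) (edge_vector u nb (val x) k) =
    sq_length u nb k.
  exact: ((enorm_eq _ _).1 (xe _ _ (adj_nb k))).
split.
- by rewrite gramE trmx_mul trmxK.
- by move=> i; rewrite mxE xk.
- move=> k; rewrite -xk edge_vector_last // -/(qf _ _) gramE qf_gram //.
Qed.

(** This will be the image of the Gram map, described by singularity instead of the topological
    boundary; the two are compared once a positive definite element is given. *)
Definition nondegenerate_faces : set 'M[R]_d.+1 :=
  [set G | [/\ gram_spectrahedron u nb q G, ~ posdef G & period_gram G \in unitmx]].

Lemma gram_range (x : realization F) : nondegenerate_faces (gram u nb (val x)).
Proof.
have [px _] : realization F (val x) by exact: set_mem (valP x).
split; last by rewrite period_gram_gram unitmx_mul unitmx_tr basis_mx_unit.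
  by split; [rewrite gramE; exact: gram_psd | exact: gram_affine_gram].
exact: gram_not_posdef.
Qed.

(** By polarization the entries depend only on distances between placed vertices. *)
Lemma gram_congruent (x y : realization F) : congruent x y ->
  gram u nb (val x) = gram u nb (val y).
Proof.
move=> [f [[_ fI] fp _]]; apply/matrixP => i j; rewrite !mxE.
have fE v w : dot ((val y).1 v - (val y).1 w) ((val y).1 v - (val y).1 w) =
    dot ((val x).1 v - (val x).1 w) ((val x).1 v - (val x).1 w).
  by apply/enorm_eq; rewrite !fp fI.
rewrite dot_polar [RHS]dot_polar /edge_vector !fE.
by rewrite !opprB ![_ - _ + (_ - _)]addrA !subrK !fE.
Qed.

Lemma place_transfer x v : placement x ->
  (same_orbit u v -> x.1 v = x.1 u + (p v - p u) *m transfer x) /\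
  (same_orbit nb0 v -> x.1 v = x.1 nb0 + (p v - p nb0) *m transfer x).
Proof.
move=> px; have [_ _ _ xa] := px; have [_ _ _ pa] := Pl.
by split=> -[g ->]; rewrite xa pa (addrAC (p _)) subrr add0r -transferE.
Qed.

(** The matrix [O] taking the period basis of [X] to that of [Y] is orthogonal because the period
    Gram matrices agree. The isometry has linear part [O] and sends the image of [u] to the image of
    [u]. *)
Lemma gram_inj (x y : realization F) :
  gram u nb (val x) = gram u nb (val y) -> congruent x y.
Proof.
have [px _] : realization F (val x) by exact: set_mem (valP x).
have [py _] : realization F (val y) by exact: set_mem (valP y).
move: px py; set X := val x; set Y := val y => px py gXY.
have uX := basis_mx_unit px; have uY := basis_mx_unit py.
pose O := invmx (basis_mx X) *m basis_mx Y.
have XO : (basis_mx X)^T = O *m (basis_mx Y)^T.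
  by rewrite /O -mulmxA -period_gram_gram -gXY period_gram_gram mulKmx.
have OO : O *m O^T = 1%:M.
  by rewrite {2}/O trmx_mul mulmxA -XO trmx_inv mulmxV // unitmx_tr.
have TO : transfer X *m O = transfer Y by rewrite /transfer /O mulmxA mulmxK.
have row0 Z : row ord0 (edge_mx Z) *m (basis_mx Z)^T =
    row ord0 (gram u nb Z) *m rowdiffmx^T.
  by rewrite basis_mxE gramE row_mul trmx_mul mulmxA.
(* The first edge vector is determined by its inner products with the period basis, and these are
   read off the common Gram matrix. *)
have vO : (X.1 nb0 - X.1 u) *m O = Y.1 nb0 - Y.1 u.
  have := row0 X; rewrite gXY -row0 XO mulmxA !rowK /edge_vector.
  by move/(congr1 (mulmx^~ (invmx (basis_mx Y)^T))); rewrite !mulmxK // unitmx_tr.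
pose f (z : 'rV[R]_d) := (z - X.1 u) *m O + Y.1 u.
exists f; split.
- split.
    exists (fun z => (z - Y.1 u) *m O^T + X.1 u) => z; rewrite /f.
      by rewrite addrK -mulmxA OO mulmx1 subrK.
    by rewrite addrK -mulmxA (mulmx1C OO) mulmx1 subrK.
  move=> a b; apply/enorm_eq; rewrite /f opprD addrACA subrr addr0 -mulmxBl.
  have -> : a - X.1 u - (b - X.1 u) = a - b by rewrite opprB addrA subrK.
  by rewrite -qf_gram OO /qf mulmx1 -dotE.
- move=> v; have [uvx nvx] := place_transfer v px; have [uvy nvy] := place_transfer v py.
  rewrite -/X -/Y /f; have [uv|nv] := nb_orbit v.
    by rewrite (uvx uv) (uvy uv) addrAC subrr add0r -mulmxA TO addrC.
  rewrite (nvx nv) (addrAC (X.1 nb0)) mulmxDl -mulmxA TO vO (nvy nv).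
  by rewrite [RHS]addrAC subrK.
- move=> g z; rewrite -/X -/Y /f addrAC mulmxDl [X in _ *m _ + X *m _]transferE //.
  by rewrite -mulmxA TO -transferE // addrAC.
Qed.

(** * Placements with a prescribed Gram matrix *)

Section Realize.
Variable G : 'M[R]_d.+1.
Variable M : 'M[R]_d.
Hypotheses (uM : M \in unitmx).
Variable v0 : 'rV[R]_d.

(* A linear image of the given placement on each of the two vertex orbits, the
   first edge vector at [u] being [v0] and the differences of the following
   ones with it being the rows of [M]. *)
Definition realize : preplace :=
  (fun v => if `[< same_orbit u v >]
            then (p v - p u) *m (invmx (basis_mx (place F)) *m M)
            else v0 + (p v - p nb0) *m (invmx (basis_mx (place F)) *m M),
   fun g => P g *m (invmx (basis_mx (place F)) *m M)).

Local Notation T := (invmx (basis_mx (place F)) *m M).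

Lemma realize_placement : placement realize.
Proof.
have uT : T \in unitmx by rewrite unitmx_mul unitmx_inv basis_mx_place_unit.
have [Pinj PD [B uB PB] Pa] := Pl; split.
- by move=> g h /= gh; apply: Pinj; rewrite -[LHS](mulmxK uT) gh mulmxK.
- by move=> g h /=; rewrite PD mulmxDl.
- exists (B *m T); first by rewrite unitmx_mul uB.
  rewrite predeqE => x; split=> [[g _ <-]|[c ->]] /=.
    have : range P (P g) by []; rewrite PB => -[c ->].
    by exists c; rewrite [RHS]mulmxA.
  have : range P (map_mx intr c *m B) by rewrite PB; exists c.
  by case=> g _ gE; exists g => //; rewrite gE [RHS]mulmxA.
- move=> g v /=.
  have -> : `[< same_orbit u (act g v) >] = `[< same_orbit u v >].
    apply/asboolP/asboolP => uv.
      apply: same_orbit_trans uv _; apply: same_orbit_sym; exact: same_orbit_act.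
    exact: same_orbit_trans uv (same_orbit_act _ _).
  by case: ifP => _; rewrite Pa addrAC mulmxDl // addrA.
Qed.

Lemma edge_vector_realize k :
  edge_vector u nb realize k = v0 + (p (nb k) - p nb0) *m T.
Proof.
rewrite /edge_vector /= asboolF; last exact: Fedge (adj_nb k).
rewrite asboolT; last by exists 0; rewrite act0.
by rewrite subrr mul0mx subr0.
Qed.

Lemma edge_mx_realize : edge_mx realize = const_mx 1 *m v0 + tailmx *m M.
Proof.
have c1 : (const_mx 1 : 'rV[R]_1) = 1%:M by apply/rowP => j; rewrite !mxE ord1.
apply/row_matrixP => i; rewrite rowK edge_vector_realize linearD /= !row_mul.
rewrite row_const c1 mul1mx; congr (_ + _); case: (unliftP ord0 i) => [j ->|->].
  have -> : p (nb (lshift r (lift ord0 j))) - p nb0 = row j (basis_mx (place F)).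
    rewrite rowK /basis_vector /period_vector /edge_vector.
    by rewrite opprB addrA subrK.
  by rewrite row_tailmx -row_mul mulKVmx ?basis_mx_place_unit // rowE.
by rewrite row0_tailmx subrr !mul0mx.
Qed.

(** At [u] the first d + 1 lengths are diagonal entries of [G] and the others are its remaining
    affine conditions. Every other edge is a translate of one at [u], up to reversal. *)
Lemma realize_realization : gram u nb realize = G -> gram_affine u nb q G ->
  realization F realize.
Proof.
move=> gG [_ Gii Gk]; have pr := realize_placement; split=> //.
have el k : edge_length realize u (nb k) = edge_length (place F) u (nb k).
  apply/enorm_eq; rewrite -/(edge_vector u nb _ k) -/(sq_length u nb k).
  rewrite -[k]splitK; case: (fintype.split k) => i /=.
    by rewrite -Gii -gG mxE.
  by rewrite edge_vector_last // -qf_gram -gramE gG -Gk.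
have nbP v : e u v -> exists k, nb k = v.
  have [_ nbE _ _] := lab => uv.
  by have : [set w | e u w] v by []; rewrite -nbE => -[k _ <-]; exists k.
have main v w : same_orbit u v -> e v w ->
    edge_length realize v w = edge_length (place F) v w.
  move=> [g ->] gw; have : e u (act (- g) w).
    by rewrite -(act_adj g) -actD subrr act0.
  move=> /nbP[k kw]; have -> : w = act g (nb k) by rewrite kw -actD subrr act0.
  by rewrite !edge_length_act //; exact: Pl.
move=> v w vw; have [uv|wv] := orbit_cases Forb Fedge vw u.
  by apply: main => //; exact: same_orbit_sym.
rewrite edge_lengthC [RHS]edge_lengthC; apply: main; first exact: same_orbit_sym.
by rewrite adj_sym.
Qed.

End Realize.

(** * Continuity of the Gram map and of its inverse *)

Lemma continuous_edge_vector k : continuous (fun x : preplace => edge_vector u nb x k).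
Proof.
have c v : continuous (fun x : preplace => x.1 v).
  move=> x; apply: (cvg_comp (fun y : preplace => y.1) (fun f => f v)).
    exact: cvg_fst.
  exact: ptws_eval_continuous.
by move=> x; apply: cvgB; exact: c.
Qed.

Lemma continuous_gram : continuous (fun x : preplace => gram u nb x).
Proof.
move=> x; apply: (@cvg_mx _ (nbhs x)) => i j; rewrite mxE.
under eq_fun do rewrite mxE.
by apply: (@cvg_dot _ _ (nbhs x)); exact: continuous_edge_vector.
Qed.

Lemma cvg_realize (T : Type) (H : set_system T) {HH : Filter H}
    (M : T -> 'M[R]_d) (v : T -> 'rV[R]_d) (M0 : 'M[R]_d) (v0 : 'rV[R]_d) :
  M @ H --> M0 -> v @ H --> v0 ->
  realize (M t) (v t) @[t --> H] --> realize M0 v0.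
Proof.
move=> MM vv.
have cT w : w *m (invmx (basis_mx (place F)) *m M t) @[t --> H] -->
    (w *m (invmx (basis_mx (place F)) *m M0) : 'rV[R]_d).
  by apply: cvg_mulmx; [exact: cvg_cst | apply: cvg_mulmx; [exact: cvg_cst|]].
apply: (cvg_pair (F := H) (f := fun t => (realize (M t) (v t)).1)
    (g := fun t => (realize (M t) (v t)).2) (G := nbhs (realize M0 v0).1)
    (H := nbhs (realize M0 v0).2)); apply: cvg_ptws => z /=; last exact: cT.
by case: ifP => _; [exact: cT | apply: cvgD; [|exact: cT]].
Qed.

Theorem gram_embedding : exists g : configuration F -> 'M[R]_d.+1,
  [/\ forall x : realization F, g (config_class x) = gram u nb (val x),
      embedding g & range g = nondegenerate_faces].
Proof.
have [c cP] := cholesky R d.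
pose v0 (G : 'M[R]_d.+1) : 'rV[R]_d :=
  row ord0 G *m rowdiffmx^T *m (invmx (c (period_gram G)))^T.
pose rz (G : 'M[R]_d.+1) := realize (c (period_gram G)) (v0 G).
have pQ G : nondegenerate_faces G -> posdef (period_gram G).
  move=> [[pG _] _ uG]; apply: psd_unit_posdef => //; rewrite period_gramE.
  split; first by rewrite !trmx_mul trmxK (proj1 pG) mulmxA.
  by move=> x; rewrite -/(qf _ _) qf_mul; exact: (proj2 pG).
have uM G : nondegenerate_faces G -> c (period_gram G) \in unitmx.
  move=> ZG; have [cc _] := cP _ (pQ _ ZG); have [_ _] := ZG.
  by rewrite -[in X in X -> _]cc unitmx_mul => /andP[].
have gram_rz G : nondegenerate_faces G -> gram u nb (rz G) = G.
  move=> ZG; have [cc _] := cP _ (pQ _ ZG); have [[pG _] nG _] := ZG.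
  by rewrite gramE edge_mx_realize; apply: gram_factor => //; exact: uM.
have real_rz G : nondegenerate_faces G -> realization F (rz G).
  move=> ZG; apply: realize_realization (gram_rz _ ZG) _; first exact: uM.
  by have [[]] := ZG.
have cvg_rz G : nondegenerate_faces G -> rz @ G --> rz G.
  move=> ZG; have [_ cc] := cP _ (pQ _ ZG).
  have cid : (fun H : 'M[R]_d.+1 => H) @ G --> G by exact: cvg_id.
  have cM : (fun H => c (period_gram H)) @ G --> c (period_gram G).
    exact: (cvg_comp (@period_gram R d) c (@continuous_period_gram R d G) cc).
  apply: (@cvg_realize _ (nbhs G)) => //.
  apply: (@cvg_mulmx _ (nbhs G)).
    apply: (@cvg_mulmx _ (nbhs G)); last exact: cvg_cst.
    apply: (@cvg_mx _ (nbhs G)) => i j; rewrite mxE; under eq_fun do rewrite mxE.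
    exact: coord_continuous.
  by apply: (@cvg_trmx _ (nbhs G)); apply: (@cvg_invmx _ (nbhs G)) => //; exact: uM.
have /choice[s sK] := @config_class_surj R d F.
(* The map is defined on a class through a chosen representative; invariance under congruence makes
   the choice harmless. *)
pose g a := gram u nb (val (s a)).
have gE (x : realization F) : g (config_class x) = gram u nb (val x).
  by apply: gram_congruent; apply/config_classP; rewrite sK.
have ginj : injective g.
  by move=> a b /gram_inj/config_classP; rewrite !sK.
have Zg a : nondegenerate_faces (g a) by exact: gram_range.
have cover G : nondegenerate_faces G ->
    exists2 x : realization F, val x = rz G & g (config_class x) = G.
  move=> ZG; exists (exist _ (rz G) (mem_set (real_rz _ ZG))) => //.
  by rewrite gE /= gram_rz.
exists g; split=> //; last first.
  rewrite predeqE => G; split=> [[a _ <-] //|/cover[x _ gx]].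
  by exists (config_class x).
split=> // U; rewrite config_class_open; split=> [[Q oQ QU]|[W oW <-]].
  (* [rz] is known to be continuous only at points of [nondegenerate_faces], so the preimage of [Q]
     need not be open and its interior is taken. *)
  exists (rz @^-1` Q)°; first exact: open_interior.
  rewrite predeqE => a; have [x xrz /ginj xa] := cover _ (Zg a).
  have QUx : Q (val x) = U a.
    by rewrite -xa; move: QU; rewrite predeqE => /(_ x) /propext.
  split=> /= [/interior_subset|Ua]; first by rewrite /= -xrz QUx.
  apply: (cvg_rz _ (Zg a)); apply: open_nbhs_nbhs; split=> //.
  by rewrite -xrz QUx.
have -> : config_class (F := F) @^-1` (g @^-1` W) =
    val @^-1` ((fun x : preplace => gram u nb x) @^-1` W).
  by rewrite predeqE => x; rewrite /= gE.
exists ((fun x : preplace => gram u nb x) @^-1` W) => //.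
by move/continuousP: continuous_gram; exact.
Qed.

(** * Compactness of the spectrahedron and its elliptope form *)

Lemma gram_affine_affine : affine_subspace (gram_affine u nb q).
Proof.
split=> [G []//|t G H [sG Gi Gk] [sH Hi Hk]]; split.
- by rewrite linearD !linearZ /= sG sH.
- by move=> i; rewrite !mxE Gi Hi; ring.
- move=> k; have := (Gk k, Hk k); rewrite -!/(qf _ _) => -[gk hk].
  by rewrite qfD !qfZ gk hk; ring.
Qed.

Lemma gram_spectrahedron_compact : compact (gram_spectrahedron u nb q).
Proof.
apply: (@mx_compact _ _ _ _ (\sum_i sq_length u nb (lshift r i))).
  have -> : gram_spectrahedron u nb q = psd R d.+1 `&`
    (\bigcap_(i in [set: 'I_d.+1]) [set G : 'M[R]_d.+1 | G i i = sq_length u nb (lshift r i)] `&`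
     \bigcap_(k in [set: 'I_r]) [set G : 'M[R]_d.+1 | qf G (edge_coef R q k) =
                                        sq_length u nb (rshift d.+1 k)]).
    rewrite predeqE => G; split=> [[pG [_ Gi Gk]]|[pG [Gi Gk]]].
      by split=> //; split=> [i _|k _]; [exact: Gi | exact: Gk].
    by split=> //; split=> [|i|k]; [exact: (proj1 pG) | exact: Gi | exact: Gk].
  apply: closedI; first exact: closed_psd.
  apply: closedI; apply: closed_bigI => i _; apply: closed_eqfun;
    try exact: cst_continuous.
    exact: coord_continuous.
  exact: continuous_qf.
move=> G i j [[sG pG] [_ Gi _]].
have G0 k : 0 <= G k k by rewrite -qf_delta; exact: pG.
rewrite -(eq_bigr _ (fun k _ => Gi k)).
have le k : G k k <= \sum_k G k k.
  by rewrite (bigD1 k) //= lerDl; apply: sumr_ge0 => l _.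
have [ii jj] := (le i, le j).
(* This is the form at e_i + t e_j; t = 1 and t = -1 bound |G i j| by the mean of [G i i] and
   [G j j], hence by the trace, which is prescribed. *)
have qij (t : R) : 0 <= G i i + 2 * t * G i j + t ^+ 2 * G j j.
  have := pG (delta_mx 0 i + t *: delta_mx 0 j).
  rewrite -/(qf _ _) qfE dotC dotDl dotZl ![dot _ (_ *m G)]dotC mulmxDl -scalemxAl.
  rewrite !dotDl !dotZl !dotE !trmx_delta -!rowE -!colE !mxE.
  have -> : G j i = G i j by rewrite -{1}sG mxE.
  by congr (0 <= _); ring.
have := (qij 1, qij (-1)) => -[q1 q2].
rewrite ler_norml; apply/andP; split; nra.
Qed.

Hypothesis Fpos : positive_edge_lengths F.

Lemma sq_length_gt0 k : 0 < sq_length u nb k.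
Proof.
by have := Fpos (adj_nb k); rewrite /edge_length enorm_gt0 -dot_gt0.
Qed.

(** Edge lengths being positive, conjugation by the diagonal matrix of their inverses rescales the
    edge vectors to unit length. It preserves semidefiniteness both ways, and [B] is the image of
    the affine conditions. *)
Lemma spectrahedron_elliptope : exists2 B, affine_subspace B &
  linearly_equivalent (gram_spectrahedron u nb q) (elliptope R d.+1 `&` B).
Proof.
pose s i : R := Num.sqrt (sq_length u nb (lshift r i)).
have s0 i : s i != 0 by rewrite sqrtr_eq0 -ltNge sq_length_gt0.
have ss i : s i * s i = sq_length u nb (lshift r i).
  by rewrite -expr2 sqr_sqrtr // ltW // sq_length_gt0.
pose D : 'M[R]_d.+1 := diag_mx (\row_i (s i)^-1).
pose E : 'M[R]_d.+1 := diag_mx (\row_i s i).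
have DT : D^T = D by exact: tr_diag_mx.
have ET : E^T = E by exact: tr_diag_mx.
have DE : D *m E = 1%:M.
  apply/matrixP => i j; rewrite mul_diag_mx !mxE.
  by case: eqVneq => [->|_]; rewrite ?mulVf // mulr0.
have ED := mulmx1C DE.
pose f : {linear 'M[R]_d.+1 -> 'M[R]_d.+1} := mulmxr D \o mulmx D.
have fE G : f G = D *m G *m D by [].
have fK : cancel f (fun G => E *m G *m E).
  by move=> G; rewrite fE !mulmxA ED mul1mx -mulmxA DE mulmx1.
have Kf : cancel (fun G => E *m G *m E) f.
  by move=> G; rewrite fE !mulmxA DE mul1mx -mulmxA ED mulmx1.
have fT G : (f G)^T = f G^T by rewrite !fE !trmx_mul DT mulmxA.
have f_psd G : psd R d.+1 G -> psd R d.+1 (f G).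
  move=> [sG pG]; split=> [|x]; first by rewrite fT sG.
  by rewrite fE -{2}DT -/(qf _ _) qf_mul; exact: pG.
have fii G i : f G i i = (s i)^-1 * G i i * (s i)^-1.
  by rewrite fE mul_mx_diag mul_diag_mx !mxE.
exists (f @` gram_affine u nb q).
  have [aS aff] := gram_affine_affine; split=> [_ [G AG <-]|t _ _ [G AG <-] [H AH <-]].
    by rewrite fT aS.
  by exists ((1 - t) *: G + t *: H); [exact: aff | rewrite linearD !linearZ].
exists f; split; first by exists (fun G => E *m G *m E).
  by move=> G; rewrite fT; split=> [/(can_inj fK)|->].
rewrite predeqE => H; split=> [[G [pG AG] <-]|[[pH _] [G AG GH]]].
  split; last by exists G.
  split=> [|i]; first exact: f_psd.
  have [_ Gi _] := AG; rewrite fii Gi -ss.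
  by rewrite mulKf // mulfV.
exists G => //; split=> //; rewrite -(fK G) GH.
split; first by rewrite !trmx_mul ET (proj1 pH) mulmxA.
by move=> x; rewrite -{2}ET -/(qf _ _) qf_mul; exact: (proj2 pH).
Qed.

End Configurations.

(** * Existence of a labelling of the neighbours *)

Section Labelling.
Variables (R : realType) (d : nat) (F : periodicFramework R d).
Local Notation V := (vertex (graph F)).
Local Notation e := (@adj d (graph F)).
Local Notation act := (@act d (graph F)).
Local Notation p := (place F).1.
Local Notation P := (place F).2.
Local Notation Pl := (placeP F).
Hypotheses (Fconn : connected_framework F) (Forb : two_orbits F)
  (Fedge : edges_join_orbits F).
Variable u : V.

(** A path from [u] to a vertex of the other orbit begins with an edge at [u], so the finite number
    of neighbours is positive. *)
Lemma neighbours_enum : exists m (w : 'I_m.+1 -> V),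
  injective w /\ forall v, e u v <-> exists k, w k = v.
Proof.
have [v uv] : exists v, e u v.
  have [z uz] : exists z, ~ same_orbit u z.
    have [a [b [ab _]]] := Forb.
    have [ua|ua] := pselect (same_orbit u a); last by exists a.
    exists b => ub; apply: ab.
    exact: same_orbit_trans (same_orbit_sym ua) ub.
  have [[|w s] /=] := Fconn u z; last by case/andP=> uw _ _; exists w.
  by move=> _ zu; case: uz; rewrite -zu; exists 0; rewrite act0.
have /finite_setP[m /card_set_bijP[f [fm finj fsurj]]] := finite_degree u.
case: m fm fsurj => [|m] fm fsurj; first by have := fm v uv.
have /choice[w wP] : forall k : 'I_m.+1, exists v, e u v /\ f v = k.
  by move=> k; have [x ux fx] := fsurj k (ltn_ord k); exists x.
exists m, w; split=> [i j ij|x]; first by apply/val_inj; rewrite /= -!(wP _).2 ij.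
split=> [ux|[k <-]]; last exact: (wP k).1.
exists (Ordinal (fm _ ux)); apply: finj; rewrite ?inE //; first exact: (wP _).1.
by rewrite (wP _).2.
Qed.

Section Span.
Variables (m : nat) (w : 'I_m.+1 -> V).
Hypothesis wE : forall v, e u v <-> exists k, w k = v.

Definition neighbour_diffs : 'M[R]_(m.+1, d) := \matrix_k (p (w k) - p (w ord0)).

(* The invariant holds along every path from [u], because two consecutive
   edges of a path change the orbit twice. *)
Lemma period_span g : (P g <= neighbour_diffs)%MS.
Proof.
have [Pinj PD _ Pa] := Pl.
have uw k : e u (w k) by apply/wE; exists k.
have wS k : (p (w k) - p (w ord0) <= neighbour_diffs)%MS.
  by rewrite -(rowK (fun k => p (w k) - p (w ord0)) k) row_sub.
(* The vertex is a translate of [u] or of its first neighbour by a period in the span of the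
   differences. *)
pose Q v := (exists2 h, v = act h u & (P h <= neighbour_diffs)%MS) \/
            (exists2 h, v = act h (w ord0) & (P h <= neighbour_diffs)%MS).
have adj_shift h x y : e (act h x) y -> e x (act (- h) y).
  by rewrite -(act_adj (- h)) -actD addNr act0.
have QE x y : e x y -> Q x -> Q y.
  move=> xy [[h xh Ph]|[h xh Ph]]; move: xy; rewrite xh => /adj_shift hy.
    right; have [k kw] := (wE _).1 hy.
    have [|[l lk]] := orbit_cases Forb Fedge (uw ord0) (w k).
      by move/(Fedge (uw k)).
    exists (h + l); first by rewrite actD -lk kw -actD subrr act0.
    rewrite PD addmx_sub //; have := wS k.
    by rewrite lk Pa addrAC subrr add0r.
  left; have [[l ly]|] := orbit_cases Forb Fedge (uw ord0) (act (- h) y); last first.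
    by move/(Fedge hy).
  have yE : y = act (h + l) u by rewrite actD -ly -actD subrr act0.
  exists (h + l) => //; rewrite PD addmx_sub //.
  have := hy; rewrite ly adj_sym => /adj_shift /wE[k kw].
  have := wS k; rewrite kw Pa addrAC subrr add0r (homN PD).
  by rewrite -scaleN1r => /(scalemx_sub (-1)); rewrite scalerA mulrN1 opprK scale1r.
have QP x s : path e x s -> Q x -> Q (last x s).
  by elim: s x => //= y s IH x /andP[xy ys] Qx; apply: IH => //; exact: QE xy Qx.
have [s us lu] := Fconn u (act g u).
have Qu : Q u.
  left; exists 0; first by rewrite act0.
  by rewrite (hom0 PD) sub0mx.
(* At the end of the path freeness of the action gives h = g; the other alternative would put [u] in
   the orbit of its neighbour. *)
case: (QP _ _ us Qu); rewrite lu => -[h hu Ph].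
  suff -> : g = h by [].
  apply/eqP; rewrite -subr_eq0; apply/eqP; apply: (@act_free _ _ _ u).
  by rewrite addrC actD hu -actD addNr act0.
case: (Fedge (uw ord0)); exists (- h + g).
by rewrite actD hu -actD addNr act0.
Qed.

Lemma neighbour_diffs_full : row_full neighbour_diffs.
Proof.
have [_ _ [B uB PB] _] := Pl.
rewrite -sub1mx -(mulVmx uB); apply: (submx_trans (submxMl _ _)).
apply/row_subP => j; have : range P (row j B).
  by rewrite PB; exists (delta_mx 0 j); rewrite map_delta_mx -rowE.
by case=> g _ <-; exact: period_span.
Qed.

End Span.

(** The neighbours are relisted: the reference one, then d whose differences with it are
    independent, then the rest. All differences have integer coordinates in a lattice basis, which
    makes the coefficients rational. *)
Lemma labelling_exists : exists (r : nat) (nb : 'I_(d.+1 + r) -> V)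
  (q : 'M[rat]_(r, d)), gram_labelling u nb q.
Proof.
have [m [w [winj wE]]] := neighbours_enum.
have full := neighbour_diffs_full wE.
pose f := fullrankfun full; pose E := neighbour_diffs w.
have finj : injective f by exact: fullrankfun_inj.
have uE : rowsub f E \in unitmx by exact: fullrowsub_unit.
(* The difference of index [ord0] is zero, so it cannot be a row of an invertible matrix. *)
have f0 j : f j != ord0.
  apply/negP => /eqP fj; have : row j (rowsub f E) = 0.
    by apply/rowP => k; rewrite !mxE fj subrr.
  rewrite rowE => /(congr1 (mulmx^~ (invmx (rowsub f E)))).
  rewrite mulmxK // mul0mx => /rowP/(_ j); rewrite !mxE !eqxx => /eqP.
  by rewrite oner_eq0.
pose L1 := ord0 :: [seq f j | j <- enum 'I_d].
have uL1 : uniq L1.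
  rewrite /= map_inj_uniq // enum_uniq andbT; apply/mapP => -[j _ /esym/eqP].
  by rewrite (negbTE (f0 j)).
have sL1 : size L1 = d.+1 by rewrite /= size_map size_enum_ord.
pose L := L1 ++ [seq k <- enum 'I_m.+1 | k \notin L1].
have uL : uniq L.
  rewrite cat_uniq uL1 filter_uniq ?enum_uniq // andbT /=.
  by apply/hasPn => k; rewrite mem_filter => /andP[].
have memL k : k \in L.
  by rewrite mem_cat mem_filter mem_enum andbT; case: (k \in L1).
pose r := size [seq k <- enum 'I_m.+1 | k \notin L1].
have sL : size L = (d.+1 + r)%N by rewrite size_cat sL1.
pose nb (k : 'I_(d.+1 + r)) := w (nth ord0 L k).
have nb0 : nb (lshift r ord0) = w ord0 by [].
have nbj j : nb (lshift r (lift ord0 j)) = w (f j).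
  rewrite /nb /= nth_cat size_map size_enum_ord ltn_ord.
  by rewrite add0n (nth_map j) ?size_enum_ord ?nth_ord_enum.
have [Pinj PD [B uB PB] Pa] := Pl.
have base : \matrix_j basis_vector u nb (place F) j = rowsub f E.
  apply/row_matrixP => j; rewrite row_rowsub !rowK /basis_vector /period_vector.
  by rewrite /edge_vector nbj nb0 opprB addrA subrK.
have /choice[c cP] : forall k, exists c : 'rV[int]_d,
    period_vector u nb (place F) k = map_mx intr c *m B.
  move=> k; have uw i : e u (w i) by apply/wE; exists i.
  have [|[g gk]] := orbit_cases Forb Fedge (uw ord0) (nb k).
    by move/(Fedge (uw _)).
  have : range P (P g) by []; rewrite PB => -[c cE]; exists c.
  rewrite -cE /period_vector /edge_vector nb0 gk Pa.
  by rewrite opprB addrA subrK addrAC subrr add0r.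
pose C : 'M[int]_d := \matrix_j c (lshift r (lift ord0 j)).
have EC : rowsub f E = map_mx intr C *m B.
  rewrite -base; apply/row_matrixP => j.
  by rewrite rowK row_mul -map_row rowK -cP.
(* Over either field, invertibility means that the integer determinant of [C] is nonzero. *)
have uC : (map_mx intr C : 'M[rat]_d) \in unitmx.
  have : (map_mx intr C : 'M[R]_d) \in unitmx.
    by move: uE; rewrite EC unitmx_mul => /andP[].
  by rewrite !unitmxE !unitfE !det_map_mx !intr_eq0.
pose q : 'M[rat]_(r, d) :=
  \matrix_k ((map_mx intr (c (rshift d.+1 k)) : 'rV[rat]_d) *m invmx (map_mx intr C)).
have ratr_intr n1 n2 (M : 'M[int]_(n1, n2)) :
    map_mx (ratr : rat -> R) (map_mx intr M) = map_mx intr M.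
  by apply/matrixP => i j; rewrite !mxE ratr_int.
exists r, nb, q; split.
- move=> i j /winj /eqP; rewrite nth_uniq ?sL ?ltn_ord // => /eqP ij.
  exact/val_inj.
- rewrite predeqE => v; split=> [[k _ <-]|/wE[k <-]] /=; first by apply/wE; exists (nth ord0 L k).
  have kL : (index k L < d.+1 + r)%N by rewrite -sL index_mem.
  by exists (Ordinal kL) => //; rewrite /nb /= nth_index.
- by rewrite base.
- move=> k; rewrite cP.
  have -> : map_mx intr (c (rshift d.+1 k)) = map_mx (ratr : rat -> R) (row k q) *m map_mx intr C.
    by rewrite rowK map_mxM map_invmx !ratr_intr mulmxKV // unitmxE unitfE det_map_mx
      intr_eq0 -(intr_eq0 rat) -det_map_mx -unitfE -unitmxE.
  rewrite -mulmxA -EC -base mulmx_sum_row; apply: eq_bigr => j _.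
  by rewrite [row j _]rowK [in LHS]mxE [row k q _ _]mxE.
Qed.

End Labelling.

(** * Compactification of the configuration space by the boundary sphere *)

Theorem theorem7 (R : realType) (d : nat) (F : periodicFramework R d)
    (Fconn : connected_framework F) (Forb : two_orbits F)
    (Fedge : edges_join_orbits F) (Fpos : positive_edge_lengths F)
    (u : vertex (graph F)) :
  (exists (r : nat) (nb : 'I_(d.+1 + r) -> vertex (graph F))
          (q : 'M[rat]_(r, d)), gram_labelling u nb q) /\
  forall (r : nat) (nb : 'I_(d.+1 + r) -> vertex (graph F))
         (q : 'M[rat]_(r, d)), gram_labelling u nb q ->
    let S := gram_spectrahedron u nb q in
    let bS := gram_boundary u nb q in
    [/\ spectrahedron S,
        exists2 B, affine_subspace B &
          linearly_equivalent S (elliptope R d.+1 `&` B) &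
        exists g : configuration F -> 'M[R]_d.+1,
          [/\ forall x : realization F,
                g (config_class x) = gram u nb (val x),
              embedding g, range g `<=` S &
              meets_cone_interior S ->
              [/\ compactifies g bS,
                  range g = bS `&` lattice_nondegenerate R d &
                  exists n : nat, homeomorphic bS (sphere R n)]]].
Proof.
split; first exact: labelling_exists.
move=> r nb q lab S bS; split.
- by exists (gram_affine u nb q) => //; exact: gram_affine_affine.
- exact: spectrahedron_elliptope.
have [g [gE emb gZ]] := gram_embedding Forb Fedge lab.
exists g; split=> //; first by rewrite gZ => G [].
move=> [G1 [pG1 AG1] posG1].
have affA := gram_affine_affine u nb q.
have kS : compact S by exact: gram_spectrahedron_compact.
have cS : closed S by apply: compact_closed => //; exact: norm_hausdorff.
have bSE : bS = [set G | S G /\ ~ posdef G].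
  exact: (boundary_in_slice affA AG1 posG1).
have gbS : range g = bS `&` lattice_nondegenerate R d.
  by rewrite gZ bSE predeqE => G; split=> [[]|[[]]].
split=> //; last first.
  (* The Gram matrix of the given placement is singular, hence a second point of the affine subspace
     besides [G1]. *)
  pose x0 : realization F := exist _ (place F) (mem_set (conj (placeP F) (fun _ _ _ => erefl))).
  have [[_ A0] n0 _] := gram_range Forb Fedge lab x0.
  apply: (slice_boundary_sphere affA AG1 posG1 A0 _ kS).
  by apply/eqP => h; apply: n0; rewrite h.
split=> //.
  rewrite /bS /gram_boundary boundary_in_closed //; last by move=> G [].
  by apply: compact_closedI => //; exact: closed_closure.
exists (lattice_nondegenerate R d) => //.
(* As the nonvanishing set of a continuous determinant, this set is open, which gives the openness
   of the image in the boundary. *)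
have -> : lattice_nondegenerate R d =
    (fun G : 'M[R]_d.+1 => \det (period_gram G)) @^-1` [set y | y != 0].
  by rewrite predeqE => G; rewrite /lattice_nondegenerate /= unitmxE unitfE.
apply: open_comp; last exact: open_neq.
by move=> G _; apply: (@cvg_det _ (nbhs G)); exact: continuous_period_gram.
Qed.
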